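(* Let $b\in(0,1/2)$ and suppose $a=1-b$ or $a=1/2$. Then $$\mathbf{B}'_{a,b}+\mathbf{B}'_{a,b}\;\stackrel{d}{=}\;\mathbf{B}'_{2a,b}\times\left(1+\sqrt{\frac{\mathbf{B}_{a,1/2}}{\mathbf{B}_{b,1/2-b}}}\right),$$ where all random variables appearing on the same side of the identity are independent.
   Context: For $p,q>0$, $\mathbf{B}_{p,q}$ denotes a beta random variable with density $\frac{\Gamma(p+q)}{\Gamma(p)\Gamma(q)}x^{p-1}(1-x)^{q-1}$ on $(0,1)$, and $\mathbf{B}'_{p,q}$ denotes a beta prime random variable with density $\frac{\Gamma(p+q)}{\Gamma(p)\Gamma(q)}\frac{x^{p-1}}{(1+x)^{p+q}}$ on $(0,\infty)$. $X\stackrel{d}{=}Y$ means equality in distribution. *)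

(* Defs.v *)
From HB Require Import structures.
From mathcomp Require Import all_boot all_order all_algebra.
From mathcomp Require Import all_classical all_reals all_analysis.
Set Implicit Arguments. Unset Strict Implicit. Unset Printing Implicit Defensive.
Import Order.TTheory GRing.Theory Num.Theory.
Import numFieldNormedType.Exports.
Local Open Scope classical_set_scope.
Local Open Scope ring_scope.

Section defs.
Variable R : realType.
Local Notation mu := (@lebesgue_measure R).

Definition Gammaf (p : R) : R :=
  fine (\int[mu]_(x in `]0%R, +oo[) ((x `^ (p - 1)) * expR (- x))%:E)%E.

Definition beta_density (p q : R) (x : R) : R :=
  if (0 < x) && (x < 1) then
    Gammaf (p + q) / (Gammaf p * Gammaf q) * x `^ (p - 1) * (1 - x) `^ (q - 1)
  else 0.

Definition betaprime_density (p q : R) (x : R) : R :=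
  if 0 < x then
    Gammaf (p + q) / (Gammaf p * Gammaf q) * x `^ (p - 1) / (1 + x) `^ (p + q)
  else 0.

Definition has_density d (T : measurableType d) (P : probability T R)
  (X : T -> R) (f : R -> R) : Prop :=
  forall A : set R, measurable A ->
    P (X @^-1` A) = (\int[mu]_(x in A) (f x)%:E)%E.

Definition indep2 d (T : measurableType d) (P : probability T R)
  (X Y : T -> R) : Prop :=
  forall A B : set R, measurable A -> measurable B ->
    P (X @^-1` A `&` Y @^-1` B) = (P (X @^-1` A) * P (Y @^-1` B))%E.

Definition indep3 d (T : measurableType d) (P : probability T R)
  (X Y Z : T -> R) : Prop :=
  forall A B C : set R, measurable A -> measurable B -> measurable C ->
    P (X @^-1` A `&` Y @^-1` B `&` Z @^-1` C)
    = (P (X @^-1` A) * P (Y @^-1` B) * P (Z @^-1` C))%E.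

End defs.

(* Main.v *)
Require Import Defs.
From HB Require Import structures.
From mathcomp Require Import all_boot all_order all_algebra.
From mathcomp Require Import all_classical all_reals all_analysis.
From mathcomp Require Import measurable_realfun.
From mathcomp Require Import ring lra.
Set Implicit Arguments.
Unset Strict Implicit.
Unset Printing Implicit Defensive.
Import Order.TTheory GRing.Theory Num.Theory.
Import numFieldNormedType.Exports.
Local Open Scope classical_set_scope.
Local Open Scope ring_scope.

(* Put [p = a + b].  Feynman's formula, in which
   [(1 - t^2)^(p - 1) (l + m t)^(- 2 p)] integrates over [-1 < t < 1] to a
   constant times [(l^2 - m^2)^(- p)], turns the convolution density of the sum
   at [s] into a constant times [s^(2 a - 1)] times the integral [S s] of
   [(1 + v + s)^(- 2 p)] against an explicit weight in [(n, v)].  For the product,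
   with [r = sqrt (Z / W)], the factor [(1 + r + s)^(b - 2 p)] is a constant times
   the integral of [(v - r)^(b - 1) (1 + v + s)^(- 2 p)] over [v > r]; the
   integral in [r] is then explicit up to a constant, and a two-to-one
   substitution for [z] produces the same [S s].  The two densities are thus
   proportional with finite positive factors, hence equal, both having total
   mass one; none of the constants has to be evaluated. *)

(** A common form exists because [(1 + x) (1 + s - x)] is a difference of squares in the centred
    variable, and the Feynman parameter [t] can be traded for a [v] with
    [l + m t = (1 + v + s) / (1 + v)]. On the product side the exponents of the beta laws [(a, 1/2)]
    and [(b, 1/2 - b)] are those for which the stray powers created by the substitutions cancel. The
    [r]-integral becomes that of a power of [D^2 x^2 + t^2 / x^2] minus its value at the left end,
    which produces two powers with exponent [- b]; they belong to the two preimages of [z] under a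
    map invariant by [n -> y / n], where [y = |1 - v| / (1 + v)]. The obstacle is convergence.
    Integrands are nonnegative and integrals take values in [[0, +oo]], so every exchange of order
    is Tonelli's theorem, and constants are multiplied across, never divided by. Only the beta
    integral [C1] is shown to be positive and finite; comparing total masses transfers this to the
    other side. The signs of the Gamma quotients are likewise read off from total mass one. *)

Section density.
Context d (T : measurableType d) (R : realType).
Local Open Scope ereal_scope.
Import HBNNSimple.

(** For indicators this is the hypothesis on [nu]; increasing simple functions and monotone
    convergence on both sides carry it over to [g]. *)
Lemma ge0_integral_density (m nu : {measure set T -> \bar R}) (h : T -> R)
    (g : T -> \bar R) (D : set T) :
  measurable D -> measurable_fun setT h -> (forall x, (0 <= h x)%R) ->
  (forall A, measurable A -> nu A = \int[m]_(x in A) (h x)%:E) ->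
  measurable_fun D g -> (forall x, D x -> 0 <= g x) ->
  \int[nu]_(x in D) g x = \int[m]_(x in D) (g x * (h x)%:E).
Proof.
move=> mD mh h0 nuE mg g0.
have mhE : measurable_fun D (fun x => (h x)%:E).
  by apply/measurable_EFinP; exact: measurable_funTS.
pose g_ := nnsfun_approx mD mg.
have mg_ n : measurable_fun D (fun x => (g_ n x * h x)%:E).
  by apply/measurable_EFinP; apply: measurable_funM;
    [exact: measurable_funTS | exact: measurable_funTS].
transitivity (limn (fun n => \int[nu]_(x in D) (g_ n x)%:E)).
  rewrite -monotone_convergence//.
  - apply: eq_integral => y /[!inE] yD; apply/esym/cvg_lim => //.
    by apply: cvg_nnsfun_approx.
  - by move=> n; exact/measurable_EFinP/measurable_funP.
  - by move=> n y _; rewrite lee_fin.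
  - by move=> y _ k n mn; rewrite lee_fin; exact/lefP/nd_nnsfun_approx.
rewrite [X in limn X](_ : _ =
    (fun n => \int[m]_(x in D) (g_ n x * h x)%:E)).
  rewrite -monotone_convergence//; last 2 first.
    - by move=> n x _; rewrite lee_fin mulr_ge0.
    - move=> x _ k n mn; rewrite lee_fin ler_wpM2r//.
      exact/lefP/nd_nnsfun_approx.
  apply: eq_integral => x /[!inE] Dx; apply/cvg_lim => //.
  have -> : (fun n => (g_ n x * h x)%:E) = (fun n => (g_ n x)%:E * (h x)%:E).
    by apply/funext => n; rewrite EFinM.
  apply: cvgeZr => //.
  exact: cvg_nnsfun_approx.
apply/funext => n.
transitivity (\sum_(k \in range (g_ n))
    \int[m]_(x in D) (k * (\1_(g_ n @^-1` [set k]) x * h x))%:E).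
  under eq_integral do rewrite fimfunE -fsumEFin//.
  rewrite ge0_integral_fsum//; last 2 first.
  - by move=> y; exact/measurable_EFinP/measurable_funM.
  - by move=> y x _; rewrite nnfun_muleindic_ge0.
  apply: eq_fsbigr => r _; rewrite integralZl_indic_nnsfun//.
  have [r0|r0] := ltP r 0%R.
    rewrite preimage_nnfun0// integral_indic//= set0I measure0 mule0.
    rewrite (eq_integral (cst 0)) ?integral0// => x _.
    by rewrite indic0 /= mul0r mulr0.
  under [RHS]eq_integral do rewrite EFinM.
  rewrite ge0_integralZl_EFin//; last 2 first.
  - by move=> x _; rewrite lee_fin mulr_ge0.
  - apply/measurable_EFinP; apply: measurable_funM; last exact: measurable_funTS.
    exact: measurable_indic.
  rewrite integral_indic// setIC nuE; last exact: measurableI.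
  rewrite integral_mkcondr; congr (_ * _).
  apply: eq_integral => x _; rewrite patchE indicE.
  by case: (x \in _); rewrite ?mul1r ?mul0r.
rewrite -ge0_integral_fsum//.
- apply: eq_integral => x _; rewrite fsumEFin//; congr EFin.
  rewrite [in RHS]fimfunE/= mulr_fsuml//.
  by apply: eq_fsbigr => r _; rewrite mulrA.
- move=> r; apply/measurable_EFinP.
  apply: measurable_funM => //; apply: measurable_funM; last exact: measurable_funTS.
  exact: measurable_indic.
- by move=> r x _; rewrite mulrA EFinM mule_ge0// ?nnfun_muleindic_ge0// lee_fin.
Qed.

End density.

(** * Change of variables, and Tonelli's theorem with moving domains *)

Section substitution.
Context (R : realType).
Local Notation mu := (@lebesgue_measure R).
Local Open Scope ereal_scope.

(** Half-open intervals form a pi-system, but the measures are compared only inside [E], so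
    uniqueness is applied to their restrictions to one []c, d]] at a time, which are finite.
    Countably many such intervals with rational ends cover [E]; making the cover disjoint lets the
    pieces be summed. *)
Lemma measure_eq_open (m1 m2 : {measure set (measurableTypeR R) -> \bar R})
    (E : set R) : open E ->
  (forall c d, (c < d)%R -> `[c, d]%classic `<=` E ->
     m1 `]c, d]%classic < +oo /\ m1 `]c, d]%classic = m2 `]c, d]%classic) ->
  forall A, measurable A -> A `<=` E -> m1 A = m2 A.
Proof.
move=> oE m12 A mA AE.
have loc c d : (c < d)%R -> `[c, d]%classic `<=` E ->
    forall B, measurable B -> m1 (B `&` `]c, d]) = m2 (B `&` `]c, d]).
  move=> cd cdE B mB.
  have mcd : measurable (`]c, d]%classic : set (measurableTypeR R)) by [].
  pose n1 : {measure set (measurableTypeR R) -> \bar R} := mrestr m1 mcd.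
  pose n2 : {measure set (measurableTypeR R) -> \bar R} := mrestr m2 mcd.
  (* A half-open interval cut down to []c, d]] is empty or again half-open, with its closed interval
     inside [E]. *)
  have oc (u v : R) : m1 (`]u, v] `&` `]c, d]) = m2 (`]u, v] `&` `]c, d]).
    have -> : `]u, v] `&` `]c, d] = `]Num.max u c, Num.min v d]%classic.
      apply/seteqP; split => x /=; rewrite !in_itv/= gt_max le_min.
        by move=> [/andP[-> ->] /andP[-> ->]].
      by move=> /andP[/andP[-> ->] /andP[-> ->]].
    have [uv|uv] := ltP (Num.max u c) (Num.min v d); last first.
      by rewrite set_itv_ge ?measure0// bnd_simp -leNgt.
    apply: (m12 _ _ uv _).2; apply: subset_trans cdE.
    by apply: subset_itv; rewrite bnd_simp ?le_max ?ge_min ?lexx ?orbT.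
  apply: (@measure_unique _ _ (measurableTypeR R) (@ocitv R)
    (fun n => `](- n%:R)%R, n%:R]%classic) _ _ _ _ n1 n2 _ _ B mB).
  - by [].
  - exact: ocitvI.
  - by move=> n; exists ((- n%:R)%R, n%:R%R).
  - by rewrite bigcup_itvT//.
  - by move=> _ [[u v] _ <-]; exact: oc.
  - move=> k; apply: le_lt_trans (m12 _ _ cd cdE).1.
    by apply: le_measure; rewrite ?inE//; exact: measurableI.
(* [K] enumerates the rational intervals whose closed version lies in [E]; all other codes give the
   empty set. *)
pose K (n : nat) : set R := if @unpickle (rat * rat)%type n is Some (p, q)
  then (if `[< (ratr p < ratr q :> R)%R /\ `[ratr p : R, ratr q]%classic `<=` E >]
    then `]ratr p : R, ratr q]%classic else set0) else set0.
have KE n B : measurable B -> m1 (B `&` K n) = m2 (B `&` K n).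
  move=> mB; rewrite /K; case: unpickle => [[p q]|]; last by rewrite setI0 !measure0.
  by case: asboolP => [[pq pqE]|_]; [exact: loc | rewrite setI0 !measure0].
have mK n : measurable (K n).
  by rewrite /K; case: unpickle => [[p q]|]//; case: asboolP.
have EK : A = \bigcup_n (A `&` K n).
  rewrite -setI_bigcupr; apply/esym/setIidPl => x /AE Ex.
  move: oE; rewrite openE => /(_ _ Ex)/nbhs_ballP[e/= e0 xeE].
  have [p] := @rat_in_itvoo R (x - e)%R x ltac:(by rewrite ltrBlDr ltrDl).
  have [q] := @rat_in_itvoo R x (x + e)%R ltac:(by rewrite ltrDl).
  rewrite !in_itv/= => /andP[xq qx] /andP[px xp].
  exists (pickle (p, q)); first exact: I.
  rewrite /K pickleK asboolT.
    by rewrite /= in_itv/= xp ltW.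
  split; first exact: lt_trans xq.
  move=> y /=; rewrite in_itv/= => /andP[py yq]; apply: xeE.
  have {py px} := lt_le_trans px py; have {yq qx} := le_lt_trans yq qx.
  move=> yx xy; rewrite /ball/= ltr_distlC; apply/andP; split => //.
have mI n : measurable (A `&` K n) by apply: measurableI => //; exact: mK.
have mU n : measurable (\big[setU/set0]_(k < n) (A `&` K k)).
  by apply: bigsetU_measurable => i _; exact: mI.
have mS n : measurable (seqDU (fun k => A `&` K k) n).
  by apply: measurableD; [exact: mI | exact: mU].
have tS := trivIset_seqDU (fun k => A `&` K k).
have mUS : measurable (\bigcup_n seqDU (fun k => A `&` K k) n).
  exact: bigcup_measurable.
rewrite EK seqDU_bigcup_eq (measure_semi_bigcup m1 mS tS mUS).
rewrite (measure_semi_bigcup m2 mS tS mUS).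
apply: eq_eseriesr => n _; rewrite /seqDU.
(* Removing earlier pieces commutes with intersecting with [K n], so each disjoint piece still sits
   inside a single [K n]. *)
have -> (U : set R) : (A `&` K n) `\` U = (A `\` U) `&` K n.
  by rewrite setDE setIAC.
by apply: KE; apply: measurableD => //; exact: mU.
Qed.

Lemma density_measure d (T : measurableType d) (m : {measure set T -> \bar R})
    (h : T -> R) : measurable_fun setT h -> (forall x, (0 <= h x)%R) ->
  exists nu : {measure set T -> \bar R},
    forall A, nu A = \int[m]_(x in A) (h x)%:E.
Proof.
move=> mh h0; pose nu A := \int[m]_(x in A) (h x)%:E.
have nu0 : nu set0 = 0 by rewrite /nu integral_set0.
have nuge0 A : 0 <= nu A by apply: integral_ge0 => x _; rewrite lee_fin.
have nus : semi_sigma_additive nu.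
  move=> /= A mA tA mUA; rewrite /nu ge0_integral_bigcup//=.
  - by apply: is_cvg_ereal_nneg_natsum_cond => n _ _; exact: nuge0.
  - by apply/measurable_EFinP; exact: measurable_funTS.
  - by move=> x _; rewrite lee_fin.
pose M : {measure set T -> \bar R} :=
  HB.pack nu (isMeasure.Build _ _ _ nu nu0 nuge0 nus).
by exists M.
Qed.

(** By the fundamental theorem of calculus the image under [F] of the measure [F' dx] gives []c, d]]
    the mass [F (G d) - F (G c) = d - c]; by [measure_eq_open] it is Lebesgue measure on [E]. Only
    points of the open [D] are mentioned, so half-lines are covered. *)
Lemma ge0_integral_subst_incr (D E : set R) (F F' G : R -> R)
    (f : R -> \bar R) :
  open D -> is_interval D -> open E ->
  (forall x, D x -> E (F x) /\ G (F x) = x) ->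
  (forall y, E y -> D (G y) /\ F (G y) = y) ->
  (forall x, D x -> is_derive x 1%R F (F' x)) ->
  (forall x, D x -> {for x, continuous F'}) ->
  (forall x, D x -> (0 < F' x)%R) ->
  measurable_fun E f -> (forall y, E y -> 0 <= f y) ->
  \int[mu]_(y in E) f y = \int[mu]_(x in D) (f (F x) * (F' x)%:E).
Proof.
move=> oD iD oE DE ED dF cF' F'0 mf f0.
have mD : measurable D by exact: open_measurable.
have mE : measurable E by exact: open_measurable.
have cF x : D x -> {for x, continuous F}.
  move=> Dx; apply/differentiable_continuous/derivable1_diffP.
  by case: (dF x Dx).
(* Extension by zero makes [F] and [F'] total. Points outside [D] are sent to [0], possibly a point
   of [E], but the density vanishes there, so they carry no mass. *)
have mF : measurable_fun setT (F \_ D).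
  apply/(measurable_restrictT _ mD); apply: open_continuous_measurable_fun => //.
  by move=> x; rewrite inE; exact: cF.
have mF' : measurable_fun setT (F' \_ D).
  apply/(measurable_restrictT _ mD); apply: open_continuous_measurable_fun => //.
  by move=> x; rewrite inE; exact: cF'.
have F'ge0 x : (0 <= (F' \_ D) x)%R.
  by rewrite patchE; case: ifPn => //; rewrite inE => /F'0/ltW.
have sub x y : D x -> D y -> `[x, y] `<=` D.
  by move=> Dx Dy z /=; rewrite in_itv/= => /andP[xz zy]; apply: (iD x y Dx Dy);
    rewrite xz.
have incF x y : D x -> D y -> (x < y)%R -> (F x < F y)%R.
  move=> Dx Dy xy.
  have dxy z : z \in `]x, y[%R -> D z.
    by move=> zxy; apply: (sub x y) => //; exact: subset_itv_oo_cc zxy.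
  apply: (@gtr0_derive1_lt_cc _ F x y); rewrite ?in_itv/= ?lexx ?ltW//.
  - by move=> z /dxy Dz; case: (dF z Dz).
  - by move=> z /dxy Dz; rewrite derive1E (@derive_val _ _ _ _ _ _ _ (dF z Dz)) F'0.
  - apply: continuous_in_subspaceT => z; rewrite inE => /sub; move=> /(_ Dx Dy).
    exact: cF.
have [nu nuE] : exists nu : {measure set (measurableTypeR R) -> \bar R},
    forall A : set R, nu A = \int[mu]_(x in A) ((F' \_ D) x)%:E.
  have [nu nuE] := @density_measure _ _ mu _ mF' F'ge0.
  by exists nu => A; rewrite nuE.
have [nu2 nu2E] : exists nu2 : {measure set (measurableTypeR R) -> \bar R},
    forall A, nu2 A = nu ((F \_ D) @^-1` A).
  have mF2 : @measurable_fun _ _ (measurableTypeR R) (measurableTypeR R) setT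
    (F \_ D) := mF.
  pose Fm : {mfun measurableTypeR R >-> measurableTypeR R} :=
    HB.pack (F \_ D) (isMeasurableFun.Build _ _ _ _ _ mF2).
  by exists (pushforward nu Fm).
have muE A : measurable A -> A `<=` E -> mu A = nu2 A.
  apply: measure_eq_open => // c d cd cdE.
  have [Ec Ed] : E c /\ E d.
    by split; apply: cdE; rewrite /= in_itv/= ?lexx ltW.
  have [[Dc FGc] [Dd FGd]] := (ED _ Ec, ED _ Ed).
  have Gcd : (G c < G d)%R.
    rewrite ltNge; apply/negP; rewrite le_eqVlt => /predU1P[h|h].
      by move: cd; rewrite -FGc -FGd h ltxx.
    by have := incF _ _ Dd Dc h; rewrite FGc FGd => /(lt_trans cd); rewrite ltxx.
  have mucd : mu `]c, d]%classic = (d - c)%:E.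
    by rewrite lebesgue_measure_itv/= lte_fin cd -EFinB.
  split; first by apply: (le_lt_trans _ (ltry (d - c))); rewrite -mucd.
  apply: (eq_trans mucd); rewrite nu2E nuE.
  rewrite -[in LHS]FGc -[in LHS]FGd.
  have := @continuous_FTC2 _ F' F _ _ Gcd.
  rewrite -EFinB => <-; last 3 first.
  - apply: continuous_in_subspaceT => z; rewrite inE => /sub; move=> /(_ Dc Dd).
    exact: cF'.
  - split.
    + move=> z zcd; have Dz : D z.
        by apply: (sub (G c) (G d)) => //; exact: subset_itv_oo_cc zcd.
      by case: (dF z Dz).
    + exact/cvg_at_right_filter/cF.
    + exact/cvg_at_left_filter/cF.
  - move=> z zcd; have Dz : D z.
      by apply: (sub (G c) (G d)) => //; exact: subset_itv_oo_cc zcd.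
    by rewrite derive1E (@derive_val _ _ _ _ _ _ _ (dF z Dz)).
  rewrite -integral_itv_obnd_cbnd; last first.
    apply/measurable_EFinP; apply: (measurable_funS mD).
      by apply: subset_trans (sub _ _ Dc Dd); exact: subset_itv_oc_cc.
    apply: open_continuous_measurable_fun => //.
    by move=> x; rewrite inE; exact: cF'.
  rewrite integral_mkcond [RHS]integral_mkcond; apply: eq_integral => x _.
  rewrite !patchE; have [Dx|nDx] := boolP (x \in D); last first.
    rewrite ifF; first by case: ifPn.
    apply/negbTE; apply: contra nDx; rewrite !inE/= => xcd.
    by apply: (sub (G c) (G d)) => //; exact: subset_itv_oc_cc xcd.
  (* For points of [D], strict monotonicity identifies []G c, G d]] with the preimage of []c,
     d]]. *)
  suff -> : (x \in `]G c, G d]%classic) = (x \in (F \_ D) @^-1` `]c, d]) by [].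
  have {}Dx : D x by rewrite inE in Dx.
  apply/idP/idP; rewrite !inE/= !in_itv/= patchE mem_set//.
    move=> /andP[cx xd]; rewrite -{1}FGc incF//=.
    move: xd; rewrite le_eqVlt => /predU1P[->|xd]; first by rewrite FGd.
    by rewrite -FGd ltW// incF.
  move=> /andP[cx xd]; apply/andP; split.
    rewrite ltNge; apply/negP; rewrite le_eqVlt => /predU1P[h|h].
      by move: cx; rewrite h FGc ltxx.
    by have := incF _ _ Dx Dc h; rewrite FGc => /(lt_trans cx); rewrite ltxx.
  rewrite leNgt; apply/negP => h.
  by have := incF _ _ Dd Dx h; rewrite FGd ltNge xd.
rewrite (eq_measure_integral nu2) => [|A mA AE]; last exact: muE.
transitivity (\int[pushforward nu (F \_ D : _ -> measurableTypeR R)]_(y in E) f y).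
  by apply: eq_measure_integral => A mA AE; rewrite nu2E.
rewrite ge0_integral_pushforward//; last by move=> y; rewrite inE; exact: f0.
have mFE : measurable ((F \_ D) @^-1` E) by rewrite -[X in measurable X]setTI; exact: mF.
have mfF : measurable_fun ((F \_ D) @^-1` E) (f \o (F \_ D)).
  apply: (measurable_comp mE _ mf); first by move=> _ [x Ex <-].
  exact: measurable_funTS.
rewrite (@ge0_integral_density _ _ _ mu nu (F' \_ D))//; last by move=> x /= /f0.
rewrite integral_mkcond [RHS]integral_mkcond; apply: eq_integral => x _.
rewrite !patchE/= !patchE; have [Dx|nDx] := boolP (x \in D); last first.
  by case: ifPn => // _; rewrite mule0.
rewrite ifT//; rewrite inE in Dx; rewrite inE/= patchE mem_set//.
by have [] := DE _ Dx.
Unshelve. all: by []. Qed.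

Lemma ge0_integral_oppr (E : set R) (f : R -> \bar R) :
  measurable E -> measurable_fun E f -> (forall y, E y -> 0 <= f y) ->
  \int[mu]_(y in E) f y = \int[mu]_(y in -%R @^-1` E) f (- y)%R.
Proof.
move=> mE mf f0.
rewrite -(@ge0_integral_pushforward _ _ (measurableTypeR R) (measurableTypeR R)
  R (-%R : R -> R) _ mu E f)//.
- by apply: eq_measure_integral => //= A mA AS; exact/esym/lebesgue_measureN.
- by move=> y; rewrite inE; exact: f0.
Qed.

(** A decreasing [F] is reduced to the increasing [- F], with [E] reflected through [0]. *)
Lemma ge0_integral_subst (D E : set R) (F F' G : R -> R) (f : R -> \bar R) :
  open D -> is_interval D -> open E ->
  (forall x, D x -> E (F x) /\ G (F x) = x) ->
  (forall y, E y -> D (G y) /\ F (G y) = y) ->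
  (forall x, D x -> is_derive x 1%R F (F' x)) ->
  (forall x, D x -> {for x, continuous F'}) ->
  (forall x, D x -> (0 < F' x)%R) \/ (forall x, D x -> (F' x < 0)%R) ->
  measurable_fun E f -> (forall y, E y -> 0 <= f y) ->
  \int[mu]_(y in E) f y = \int[mu]_(x in D) (f (F x) * (`|F' x|)%:E).
Proof.
move=> oD iD oE DE ED dF cF' [F'0|F'0] mf f0.
  rewrite (@ge0_integral_subst_incr D E F F' G)//.
  by apply: eq_integral => x; rewrite inE => /F'0/gtr0_norm ->.
rewrite ge0_integral_oppr//; last exact: open_measurable.
have oE' : open (-%R @^-1` E : set R).
  by move/continuousP : (@oppr_continuous R R); apply.
have dF' x : D x -> is_derive x 1%R (fun x => - F x)%R (- F' x)%R.
  by move=> /dF ?; exact: is_deriveN.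
have cF'' x : D x -> {for x, continuous (fun x => - F' x)%R}.
  by move=> /cF' ?; exact: continuousN.
have mf' : measurable_fun (-%R @^-1` E : set R) (fun y => f (- y)%R).
  apply: (measurable_comp (open_measurable oE) _ mf) => //.
  by move=> _ [x Ex <-].
have F''0 x : D x -> (0 < - F' x)%R by move=> /F'0; rewrite oppr_gt0.
have DE' x : D x -> (-%R @^-1` E) (- F x)%R /\ G (- (- F x))%R = x.
  by move=> /DE; rewrite /= opprK.
have ED' y : (-%R @^-1` E) y -> D (G (- y))%R /\ (- F (G (- y)))%R = y.
  by move=> /ED [? ->]; rewrite opprK.
have f0' y : (-%R @^-1` E) y -> 0 <= f (- y)%R by move=> /f0.
rewrite (ge0_integral_subst_incr oD iD oE' DE' ED' dF' cF'' F''0 mf' f0').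
by apply: eq_integral => x; rewrite inE => /F'0/ltr0_norm ->; rewrite opprK.
Qed.

(** Both families of slices describe one planar region; extending [f] by zero outside it reduces the
    claim to Tonelli's theorem on the whole plane. *)
Lemma ge0_tonelli_set (A A' : set R) (B B' : R -> set R)
    (f : R -> R -> \bar R) :
  measurable A -> (forall x, A x -> measurable (B x)) ->
  measurable A' -> (forall y, A' y -> measurable (B' y)) ->
  (forall x y, A x /\ B x y <-> A' y /\ B' y x) ->
  measurable [set z : R * R | A z.1 /\ B z.1 z.2] ->
  measurable_fun setT (fun z : R * R => f z.1 z.2) ->
  (forall x y, A x -> B x y -> 0 <= f x y) ->
  \int[mu]_(x in A) \int[mu]_(y in B x) f x y =
  \int[mu]_(y in A') \int[mu]_(x in B' y) f x y.
Proof.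
move=> mA mB mA' mB' AB mC mf f0.
pose C := [set z : R * R | A z.1 /\ B z.1 z.2].
pose h z := ((fun z => f z.1 z.2) \_ C) z.
have mh : measurable_fun setT h.
  by apply/(measurable_restrictT _ mC); exact: measurable_funTS.
have h0 z : 0 <= h z.
  by rewrite /h patchE; case: ifPn => //; rewrite inE => -[]; exact: f0.
have := @fubini_tonelli _ _ (measurableTypeR R) (measurableTypeR R) R mu mu h.
move=> /(_ mh h0) tH.
transitivity (\int[mu]_x \int[mu]_y h (x, y)).
  rewrite integral_mkcond; apply: eq_integral => x _; rewrite patchE.
  case: ifPn => [/set_mem Ax|/negP Ax].
    rewrite integral_mkcond; apply: eq_integral => y _.
    rewrite /h !patchE; congr (if _ then _ else _).
    by apply/idP/idP => /set_mem h1; apply/mem_set; [split | case: h1].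
  rewrite integral0_eq// => y _; rewrite /h patchE ifF//.
  by apply/negP => /set_mem[/= Ax' _]; apply/Ax/mem_set.
rewrite tH [RHS]integral_mkcond; apply: eq_integral => y _; rewrite patchE.
case: ifPn => [/set_mem Ay|/negP Ay].
  rewrite [RHS]integral_mkcond; apply: eq_integral => x _.
  rewrite /h !patchE; congr (if _ then _ else _).
  by apply/idP/idP => /set_mem h1; apply/mem_set; [have /AB[] := h1 | apply/AB].
rewrite integral0_eq// => x _; rewrite /h patchE ifF//.
by apply/negP => /set_mem/AB[Ay' _]; apply/Ay/mem_set.
Qed.

End substitution.

(** The inverse comes from the intermediate value theorem and strict monotonicity, so only [F] and
    its end values have to be supplied. The sign of [F'] is required in the open interval only: in
    the fold below, [F'] vanishes at the turning point. *)
Lemma ge0_integral_subst_itv (R : realType) (u v : R) (F F' : R -> R)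
    (f : R -> \bar R) (E : set R) : u < v ->
  (forall x, u <= x <= v -> is_derive x 1 F (F' x)) ->
  (forall x, u < x < v -> {for x, continuous F'}) ->
  ((forall x, u < x < v -> 0 < F' x) /\ E = `]F u, F v[%classic) \/
  ((forall x, u < x < v -> F' x < 0) /\ E = `]F v, F u[%classic) ->
  measurable_fun E f -> (forall y, E y -> (0 <= f y)%E) ->
  (\int[lebesgue_measure]_(y in E) f y =
   \int[lebesgue_measure]_(x in `]u, v[) (f (F x) * (`|F' x|)%:E))%E.
Proof.
move=> uv dF cF' sgn mf f0.
have cF : {within `[u, v], continuous F}.
  apply: continuous_in_subspaceT => z; rewrite inE/= in_itv/= => /dF [? _].
  exact/differentiable_continuous/derivable1_diffP.
have dF1 x : x \in `]u, v[%R -> derivable F x 1 /\ derive1 F x = F' x.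
  rewrite in_itv/= => /andP[ux xv].
  have dFx : is_derive x 1 F (F' x) by apply: dF; rewrite !ltW.
  by split; [case: dFx | rewrite derive1E (@derive_val _ _ _ _ _ _ _ dFx)].
have uI : u \in `[u, v] by rewrite in_itv/= lexx ltW.
have vI : v \in `[u, v] by rewrite in_itv/= lexx ltW.
have ooI x : x \in `]u, v[ -> x \in `[u, v] by exact: subset_itv_oo_cc.
have ex (y : R) : exists x, E y -> u < x < v /\ F x = y.
  have [Ey|] := pselect (E y); last by exists 0.
  have [|x xuv Fx] := @IVT _ F u v y (ltW uv) cF.
    case: sgn Ey => -[_ ->] /=; rewrite in_itv/= => /andP[y1 y2].
    + by rewrite ge_min le_max (ltW y1) (ltW y2) orbT.
    + by rewrite ge_min le_max (ltW y1) (ltW y2) orbT.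
  exists x => _; split => //; move: xuv; rewrite in_itv/= !le_eqVlt.
  move=> /andP[/predU1P[xu|->] /predU1P[xv|->]] //; exfalso.
  - by move: uv; rewrite xu xv ltxx.
  - by case: sgn Ey => -[_ ->] /=; rewrite in_itv/= xu Fx ltxx ?andbF.
  - by case: sgn Ey => -[_ ->] /=; rewrite in_itv/= -xv Fx ltxx ?andbF.
pose G y := projT1 (cid (ex y)).
have GP y : E y -> u < G y < v /\ F (G y) = y := projT2 (cid (ex y)).
have key x : u < x < v -> E (F x) /\ G (F x) = x.
  move=> xuv; have xI : x \in `]u, v[ by rewrite in_itv.
  case: sgn => -[sg EE].
    have inc := @gtr0_derive1_lt_cc _ F u v (fun x h => (dF1 x h).1)
      (fun x h => eq_ind_r (fun t => 0 < t) (sg x h) (dF1 x h).2) cF.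
    have EF : E (F x).
      by case/andP: xuv => ux xv; rewrite EE/= in_itv/=; apply/andP; split;
        apply: inc => //; exact: ooI.
    split=> //; have [Guv FG] := GP _ EF.
    have GI : G (F x) \in `]u, v[ by rewrite in_itv.
    have [h|h|//] := ltgtP (G (F x)) x.
    + by have := inc _ _ (ooI _ GI) (ooI _ xI) h; rewrite FG ltxx.
    + by have := inc _ _ (ooI _ xI) (ooI _ GI) h; rewrite FG ltxx.
  have dec := @ltr0_derive1_lt_cc _ F u v (fun x h => (dF1 x h).1)
      (fun x h => eq_ind_r (fun t => t < 0) (sg x h) (dF1 x h).2) cF.
  have EF : E (F x).
    by case/andP: xuv => ux xv; rewrite EE/= in_itv/=; apply/andP; split;
      apply: dec => //; exact: ooI.
  split=> //; have [Guv FG] := GP _ EF.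
  have GI : G (F x) \in `]u, v[ by rewrite in_itv.
  have [h|h|//] := ltgtP (G (F x)) x.
  + by have := dec _ _ (ooI _ xI) (ooI _ GI) h; rewrite FG ltxx.
  + by have := dec _ _ (ooI _ GI) (ooI _ xI) h; rewrite FG ltxx.
apply: (@ge0_integral_subst _ _ _ _ _ G) => //.
- exact: interval_is_interval.
- by case: sgn => -[_ ->].
- by move=> x /=; rewrite in_itv/= => /andP[? ?]; apply: dF; rewrite !ltW.
- by case: sgn => -[sg _]; [left|right] => x /=; rewrite in_itv/=; exact: sg.
Qed.

(** Real powers are measurable, and [x^-1 = x (x^2)^(-1)] involves a power of a nonnegative base; at
    [0] both sides are [0]. *)
Lemma measurable_invr (R : realType) : measurable_fun setT (fun x : R => x^-1).
Proof.
have -> : (fun x : R => x^-1) = (fun x => x * (x ^+ 2) `^ (-1)).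
  apply/funext => x; have [->|x0] := eqVneq x 0; first by rewrite invr0 mul0r.
  by rewrite powR_inv1 ?sqr_ge0// expr2 invfM mulrA divff// mul1r.
apply: measurable_funM => //.
apply: (measurableT_comp (measurable_powR (-1))); exact: exprn_measurable.
Qed.

Lemma measurable_sqrtr (R : realType) :
  measurable_fun setT (@Num.sqrt R).
Proof. by apply: continuous_measurable_fun; exact: sqrt_continuous. Qed.

(** * Tactics for measurability, real powers and derivatives *)

Ltac mfun := lazymatch goal with
  | |- measurable_fun _ (fun z => EFin (@?f z)) => apply/measurable_EFinP; mfun
  | |- measurable_fun ?D (fun z => @GRing.mul _ (@?f z) (@?g z)) =>
      apply: (@measurable_funM _ _ _ D f g); mfun
  | |- measurable_fun ?D (fun z => @GRing.add _ (@?f z) (@GRing.opp _ (@?g z))) =>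
      apply: (@measurable_funB _ _ _ D f g); mfun
  | |- measurable_fun ?D (fun z => @GRing.add _ (@?f z) (@?g z)) =>
      apply: (@measurable_funD _ _ _ D f g); mfun
  | |- measurable_fun ?D (fun z => @GRing.opp _ (@?f z)) =>
      apply: (@measurable_funN _ _ _ D f); mfun
  | |- measurable_fun ?D (fun z => @GRing.exp _ (@?f z) ?n) =>
      apply: (@measurable_funX _ _ _ D f n); mfun
  | |- measurable_fun ?D (fun z => @GRing.inv _ (@?f z)) =>
      apply: (@measurableT_comp _ _ _ _ _ _ _ D f (@measurable_invr _)); mfun
  | |- measurable_fun ?D (fun z => powR (@?f z) ?p) =>
      apply: (@measurableT_comp _ _ _ _ _ _ _ D f (@measurable_powR _ p)); mfun
  | |- measurable_fun ?D (fun z => Num.sqrt (@?f z)) =>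
      apply: (@measurableT_comp _ _ _ _ _ _ _ D f (@measurable_sqrtr _)); mfun
  | |- measurable_fun ?D (fun z => Num.norm (@?f z)) =>
      apply: (@measurableT_comp _ _ _ _ _ _ _ D f (@normr_measurable _ setT)); mfun
  | |- measurable_fun _ (fun z => fst z) => apply: measurable_funTS; exact: measurable_fst
  | |- measurable_fun _ (fun z => snd z) => apply: measurable_funTS; exact: measurable_snd
  | |- measurable_fun ?D (fun _ => ?c) => exact: (@measurable_cst _ _ _ _ D c)
  | |- measurable_fun _ (fun x => x) => exact: measurable_id
  | |- _ => idtac end.

Lemma powR_expR (R : realType) (x p : R) : expR x `^ p = expR (p * x).
Proof. by rewrite /powR gt_eqF ?expR_gt0// expRK. Qed.

Lemma gt0_expR (R : realType) (x : R) : 0 < x -> exists u, x = expR u.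
Proof. by move=> x0; exists (ln x); rewrite lnK. Qed.

(** Once every positive base is written as [expR u], an identity between products of real powers
    becomes a rational identity between exponents. *)
Ltac pw := rewrite ?expr2 -?expRN -?expRD; repeat (rewrite ?powR_expR -?expRN -?expRD);
  congr expR; field; rewrite ?pnatr_eq0 ?andbT //.

Section derive_lambda.
Variables (R : realType) (f g : R -> R) (x : R).

Lemma derive_lamC (c : R) : is_derive x 1 (fun=> c) 0.
Proof. exact: is_derive_cst. Qed.
Lemma derive_lamI : is_derive x 1 (fun y : R => y) 1.
Proof. exact: is_derive_id. Qed.
Lemma derive_lamD (a b : R) : is_derive x 1 f a -> is_derive x 1 g b ->
  is_derive x 1 (fun y => f y + g y) (a + b).
Proof. by move=> ? ?; exact: is_deriveD. Qed.
Lemma derive_lamN (a : R) : is_derive x 1 f a ->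
  is_derive x 1 (fun y => - f y) (- a).
Proof. by move=> ?; exact: is_deriveN. Qed.
Lemma derive_lamM (a b : R) : is_derive x 1 f a -> is_derive x 1 g b ->
  is_derive x 1 (fun y => f y * g y) (f x * b + g x * a).
Proof. by move=> ? ?; exact: is_deriveM. Qed.
Lemma derive_lamX (a : R) : is_derive x 1 f a ->
  is_derive x 1 (fun y => f y ^+ 2) (2 * f x * a).
Proof.
move=> df; rewrite (_ : (fun y => f y ^+ 2) = (fun y => f y * f y)).
  by rewrite (_ : 2 * f x * a = f x * a + f x * a); [exact: is_deriveM|ring].
by apply/funext => y; rewrite expr2.
Qed.
Lemma derive_lamV (a : R) : f x != 0 -> is_derive x 1 f a ->
  is_derive x 1 (fun y => (f y)^-1) (- (f x) ^- 2 * a).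
Proof. by move=> f0 df; exact: is_deriveV. Qed.
Lemma derive_lam_eq (a b : R) : is_derive x 1 f a -> a = b -> is_derive x 1 f b.
Proof. by move=> ? <-. Qed.
Lemma derive_cont (a : R) : is_derive x 1 f a -> {for x, continuous f}.
Proof. by move=> [df _]; exact/differentiable_continuous/derivable1_diffP. Qed.
End derive_lambda.

(** The derivative is built into an existential variable from the shape of the function; [dereq]
    compares it with the announced one, while [dcont] keeps only the continuity. *)
Ltac der := lazymatch goal with
  | |- is_derive ?x _ (fun _ => ?c) _ => exact: (@derive_lamC _ x c)
  | |- is_derive ?x _ (fun y => y) _ => exact: (@derive_lamI _ x)
  | |- is_derive ?x _ (fun y => @GRing.add _ (@?f y) (@?g y)) _ =>
      eapply (@derive_lamD _ f g x); [der|der]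
  | |- is_derive ?x _ (fun y => @GRing.opp _ (@?f y)) _ =>
      eapply (@derive_lamN _ f x); der
  | |- is_derive ?x _ (fun y => @GRing.mul _ (@?f y) (@?g y)) _ =>
      eapply (@derive_lamM _ f g x); [der|der]
  | |- is_derive ?x _ (fun y => @GRing.exp _ (@?f y) 2) _ =>
      eapply (@derive_lamX _ f x); der
  | |- is_derive ?x _ (fun y => @GRing.inv _ (@?f y)) _ =>
      eapply (@derive_lamV _ f x); [ | der]
  end.
Ltac dereq := eapply derive_lam_eq; [der|].
Ltac dcont := eapply derive_cont; der.
Ltac nz := repeat (apply/andP; split); first [done | by rewrite gt_eqF |
  by rewrite gt_eqF ?exprn_gt0 | (rewrite gt_eqF//; nra)].

(** * Scaling and Feynman's parameter integral *)

Section scaling_and_feynman.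
Variable R : realType.
Local Notation mu := (@lebesgue_measure R).
Local Open Scope ereal_scope.

(** The substitution [X = sqrt C x] has Jacobian [C^(1/2)], which turns [C^(- 1/2 - b)] into
    [C^(- b)]. *)
Lemma integral_sqrB_scale (b C : R) : (0 < C)%R ->
  \int[mu]_(X in `](Num.sqrt C), +oo[) ((X ^+ 2 - C) `^ (- 2^-1 - b))%:E =
  (C `^ (- b))%:E * \int[mu]_(x in `]1%R, +oo[) ((x ^+ 2 - 1) `^ (- 2^-1 - b))%:E.
Proof.
move=> C0; have sC : (0 < Num.sqrt C)%R by rewrite sqrtr_gt0.
have sC2 : (Num.sqrt C ^+ 2 = C)%R by rewrite sqr_sqrtr// ltW.
etransitivity.
  apply: (@ge0_integral_subst R `]1%R, +oo[ `](Num.sqrt C), +oo[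
  (fun x => Num.sqrt C * x)%R (fun=> Num.sqrt C) (fun y => y / Num.sqrt C)%R) => //.
  - exact: interval_is_interval.
  - move=> x /=; rewrite !in_itv/= !andbT => x1; split; first by rewrite -{1}(mulr1 (Num.sqrt C)) ltr_pM2l.
    by rewrite mulrAC divff ?mul1r ?gt_eqF.
  - move=> x /=; rewrite !in_itv/= !andbT => x1; split; first by rewrite ltr_pdivlMr// mul1r.
    by rewrite mulrCA divff ?mulr1 ?gt_eqF.
  - by move=> x _; dereq; ring.
  - by move=> x _; dcont.
  - by left.
  - by mfun.
  - by move=> y _; rewrite lee_fin powR_ge0.
rewrite -ge0_integralZl_EFin//; last 3 first.
+ by move=> x _; rewrite lee_fin powR_ge0.
+ by mfun.
+ exact: powR_ge0.
apply: eq_integral => x; rewrite inE/= in_itv/= andbT => x1.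
rewrite -!EFinM; congr EFin.
rewrite exprMn sC2 -{2}(mulr1 C) -mulrBr gtr0_norm//.
have [u ->] : exists u, (x ^+ 2 - 1)%R = expR u.
  by apply: gt0_expR; rewrite subr_gt0 exprn_egt1.
have [v Ev] := gt0_expR sC.
rewrite Ev -sC2 Ev; pw.
Qed.

(** The Moebius map [t = (l x - m) / (l - m x)] preserves []-1, 1[]. With [k = l^2 - m^2] and
    [d = l - m x], it gives [1 - t^2 = k (1 - x^2) / d^2], [l + m t = k / d] and [dt = k / d^2 dx]:
    the powers of [d] cancel and [k] is left with exponent [(p - 1) - 2 p + 1 = - p]. *)
Lemma feynman_parameter (p l m : R) : (`|m| < l)%R ->
  \int[mu]_(t in `](-1)%R, 1%R[) ((1 - t ^+ 2) `^ (p - 1) * (l + m * t) `^ (- (2 * p)))%:E =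
  ((l ^+ 2 - m ^+ 2) `^ (- p))%:E *
  \int[mu]_(t in `](-1)%R, 1%R[) ((1 - t ^+ 2) `^ (p - 1))%:E.
Proof.
rewrite ltr_norml => /andP[m1 m2].
have lm0 x : (-1 < x)%R -> (x < 1)%R -> (0 < l - m * x)%R by move=> ? ?; nra.
have l2 : (0 < l ^+ 2 - m ^+ 2)%R by nra.
etransitivity.
  apply: (@ge0_integral_subst R `](-1)%R, 1%R[ `](-1)%R, 1%R[
  (fun x => (l * x - m) / (l - m * x))%R
  (fun x => (l ^+ 2 - m ^+ 2) / (l - m * x) ^+ 2)%R
  (fun y => (l * y + m) / (l + m * y))%R) => //.
  - exact: interval_is_interval.
  - move=> x /=; rewrite !in_itv/= => /andP[x1 x2]; have d0 := lm0 x x1 x2; split.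
      by rewrite ltr_pdivlMr// ltr_pdivrMr//; apply/andP; split; nra.
    by field; nz.
  - move=> x /=; rewrite !in_itv/= => /andP[x1 x2].
    have d0 : (0 < l + m * x)%R by nra.
    split.
      by rewrite ltr_pdivlMr// ltr_pdivrMr//; apply/andP; split; nra.
    by field; nz.
  - move=> x /=; rewrite !in_itv/= => /andP[x1 x2]; have d0 := lm0 x x1 x2.
    by dereq; [rewrite gt_eqF | field; rewrite gt_eqF].
  - move=> x /=; rewrite !in_itv/= => /andP[x1 x2]; have d0 := lm0 x x1 x2.
    by dcont; rewrite gt_eqF ?exprn_gt0.
  - left => x /=; rewrite !in_itv/= => /andP[x1 x2]; have d0 := lm0 x x1 x2.
    by rewrite divr_gt0// exprn_gt0.
  - by mfun.
  - by move=> y _; rewrite lee_fin mulr_ge0 ?powR_ge0.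
rewrite -ge0_integralZl_EFin//; last 3 first.
+ by move=> x _; rewrite lee_fin powR_ge0.
+ by mfun.
+ exact: powR_ge0.
apply: eq_integral => x; rewrite inE/= in_itv/= => /andP[x1 x2].
rewrite -!EFinM; congr EFin.
have d0 := lm0 x x1 x2.
have x20 : (0 < 1 - x ^+ 2)%R by nra.
rewrite gtr0_norm ?divr_gt0 ?exprn_gt0//.
have -> : (1 - ((l * x - m) / (l - m * x)) ^+ 2 =
   (l ^+ 2 - m ^+ 2) * (1 - x ^+ 2) * (l - m * x)^-1 * (l - m * x)^-1)%R.
  by field; rewrite gt_eqF.
have -> : (l + m * ((l * x - m) / (l - m * x)) =
   (l ^+ 2 - m ^+ 2) * (l - m * x)^-1)%R.
  by field; rewrite gt_eqF.
have [u ->] := gt0_expR d0; have [v ->] := gt0_expR l2; have [w ->] := gt0_expR x20.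
pw.
Qed.
End scaling_and_feynman.

(** * One-variable integrals of the product side *)

Section inner_integrals.
Variable R : realType.
Local Notation mu := (@lebesgue_measure R).
Local Open Scope ereal_scope.

(** With [x = r + (r + k) / y], both [x - r] and [x + k] are multiples of [r + k], which comes out
    with exponent [(b - 1) - q + 1]. The integral that remains is a beta integral. *)
Lemma integral_frac_pow (b q r k : R) : (0 < r + k)%R ->
  \int[mu]_(x in `]r, +oo[) ((x - r) `^ (b - 1) * (x + k) `^ (- q))%:E =
  ((r + k) `^ (b - q))%:E *
  \int[mu]_(y in `]0%R, +oo[) (y `^ (q - b - 1) * (1 + y) `^ (- q))%:E.
Proof.
move=> c0.
etransitivity.
  apply: (@ge0_integral_subst R `]0%R, +oo[ `]r, +oo[
  (fun y => r + (r + k) / y)%R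
  (fun y => - (r + k) / y ^+ 2)%R
  (fun x => (r + k) / (x - r))%R) => //.
  - exact: interval_is_interval.
  - move=> x /=; rewrite !in_itv/= !andbT => x0; split.
      by rewrite ltrDl divr_gt0.
    by field; nz.
  - move=> x /=; rewrite !in_itv/= !andbT => x0.
    have x1 : (0 < x - r)%R by rewrite subr_gt0.
    split; first by rewrite divr_gt0.
    by field; nz.
  - move=> x /=; rewrite !in_itv/= !andbT => x0.
    by dereq; [nz | field; nz].
  - move=> x /=; rewrite !in_itv/= !andbT => x0.
    by dcont; nz.
  - right => x /=; rewrite !in_itv/= !andbT => x0.
    by rewrite mulNr oppr_lt0 divr_gt0// exprn_gt0.
  - by mfun.
  - by move=> y _; rewrite lee_fin mulr_ge0 ?powR_ge0.
rewrite -ge0_integralZl_EFin//; last 3 first.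
+ by move=> y _; rewrite lee_fin mulr_ge0 ?powR_ge0.
+ by mfun.
+ exact: powR_ge0.
apply: eq_integral => y; rewrite inE/= in_itv/= andbT => y0.
rewrite -!EFinM; congr EFin.
have y10 : (0 < 1 + y)%R by rewrite addr_gt0.
have -> : (r + (r + k) / y - r = (r + k) / y)%R by ring.
have -> : (r + (r + k) / y + k = (r + k) * (1 + y) / y)%R by field; nz.
rewrite mulNr normrN gtr0_norm ?divr_gt0 ?exprn_gt0//.
have [u ->] := gt0_expR c0; have [v ->] := gt0_expR y10.
have [w ->] := gt0_expR y0; pw.
Qed.

(** Here [r = sqrt (z / w)]. The two factors and the Jacobian [2 z r^(-3)] contribute the powers
    [2 - 2 b], [1 + 2 b] and [- 3] of [r], which cancel because [b - 1] and [- 1/2 - b] add up to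
    [- 3/2]. *)
Lemma integral_beta_sqrt_ratio (b z : R) (g : R -> R) : (0 < z)%R ->
  measurable_fun setT g -> (forall x, 0 <= g x)%R ->
  \int[mu]_(w in `]0%R, 1%R[)
    (w `^ (b - 1) * (1 - w) `^ (- 2^-1 - b) * g (Num.sqrt (z / w)))%:E =
  \int[mu]_(r in `](Num.sqrt z), +oo[)
    (2 * z `^ b * (r ^+ 2 - z) `^ (- 2^-1 - b) * g r)%:E.
Proof.
move=> z0 mg g0.
have sz : (0 < Num.sqrt z)%R by rewrite sqrtr_gt0.
have sz2 : (Num.sqrt z ^+ 2 = z)%R by rewrite sqr_sqrtr// ltW.
have gtz r : (Num.sqrt z < r)%R -> (0 < r)%R /\ (z < r ^+ 2)%R.
  move=> zr; have r0 := lt_trans sz zr; split => //.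
  by rewrite -sz2 ltr_pXn2r// nnegrE ltW.
etransitivity.
  apply: (@ge0_integral_subst R `](Num.sqrt z), +oo[ `]0%R, 1%R[
  (fun r => z / r ^+ 2)%R
  (fun r => - (2 * z) / (r * r ^+ 2))%R
  (fun w => Num.sqrt (z / w))%R) => //.
  - exact: interval_is_interval.
  - move=> r /=; rewrite !in_itv/= !andbT => zr; have [r0 zr2] := gtz r zr; split.
      by rewrite divr_gt0 ?exprn_gt0//= ltr_pdivrMr ?exprn_gt0// mul1r.
    have -> : (z / (z / r ^+ 2) = r ^+ 2)%R by field; nz.
    by rewrite sqrtr_sqr gtr0_norm.
  - move=> w /=; rewrite !in_itv/= !andbT => /andP[w0 w1]; split.
      by rewrite ltr_sqrt ?divr_gt0// ltr_pdivlMr// gtr_pMr.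
    rewrite sqr_sqrtr; last by rewrite ltW// divr_gt0.
    by field; nz.
  - move=> x /=; rewrite !in_itv/= !andbT => /gtz[x0 _].
    by dereq; [nz | field; nz].
  - move=> x /=; rewrite !in_itv/= !andbT => /gtz[x0 _].
    by dcont; rewrite gt_eqF// mulr_gt0 ?exprn_gt0.
  - right => x /=; rewrite !in_itv/= !andbT => /gtz[x0 _].
    by rewrite mulNr oppr_lt0 divr_gt0 ?mulr_gt0 ?exprn_gt0.
  - apply/measurable_EFinP; apply: measurable_funM; first by mfun.
    apply: (measurableT_comp mg); mfun.
  - by move=> y _; rewrite lee_fin !mulr_ge0 ?powR_ge0.
apply: eq_integral => r; rewrite inE/= in_itv/= andbT => zr.
have [r0 zr2] := gtz r zr.
rewrite -!EFinM; congr EFin.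
have -> : (z / (z / r ^+ 2) = r ^+ 2)%R by field; nz.
rewrite sqrtr_sqr gtr0_norm//.
rewrite mulNr normrN gtr0_norm ?divr_gt0 ?mulr_gt0 ?exprn_gt0//.
have rz : (0 < r ^+ 2 - z)%R by rewrite subr_gt0.
have -> : (1 - z / r ^+ 2 = (r ^+ 2 - z) / r ^+ 2)%R by field; nz.
have H : ((z / r ^+ 2) `^ (b - 1) * ((r ^+ 2 - z) / r ^+ 2) `^ (- 2^-1 - b) *
    (z / (r * r ^+ 2)) = z `^ b * (r ^+ 2 - z) `^ (- 2^-1 - b))%R.
  have [u ->] := gt0_expR rz; have [v ->] := gt0_expR z0.
  by have [w ->] := gt0_expR r0; pw.
transitivity (2 * g r * ((z / r ^+ 2) `^ (b - 1) *
    ((r ^+ 2 - z) / r ^+ 2) `^ (- 2^-1 - b) * (z / (r * r ^+ 2))))%R.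
  by field; nz.
by rewrite H; ring.
Qed.

(* [(D x -/+ t / x)^2] differ from the base of the left-hand integrand by
   constants, and the derivatives of [D x -/+ t / x] add up to [2 D]. *)
Lemma integral_two_branches (b D t x0 : R) : (0 < D)%R -> (0 < t)%R ->
  (0 < x0)%R -> (t < D * x0 ^+ 2)%R ->
  \int[mu]_(x in `]x0, +oo[)
    (2 * D * (D ^+ 2 * x ^+ 2 + t ^+ 2 / x ^+ 2
       - (D ^+ 2 * x0 ^+ 2 + t ^+ 2 / x0 ^+ 2)) `^ (- 2^-1 - b))%:E =
  (((D * x0 - t / x0) ^+ 2) `^ (- b) + ((D * x0 + t / x0) ^+ 2) `^ (- b))%:E *
  \int[mu]_(x in `]1%R, +oo[) ((x ^+ 2 - 1) `^ (- 2^-1 - b))%:E.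
Proof.
move=> D0 t0 x00 tD.
have pos x : (x0 < x)%R -> (0 < x)%R by exact: lt_trans.
have tDx x : (x0 < x)%R -> (t < D * x ^+ 2)%R.
  move=> xx0; apply: (lt_trans tD); rewrite ltr_pM2l// ltr_pXn2r// nnegrE ltW//.
  exact: pos.
set cm := (D * x0 - t / x0)%R; set cp := (D * x0 + t / x0)%R.
have cm0 : (0 < cm)%R.
  by rewrite subr_gt0 ltr_pdivrMr// -mulrA -expr2.
have cp0 : (0 < cp)%R by rewrite /cp addr_gt0 ?mulr_gt0 ?invr_gt0.
have cmp : (cp ^+ 2 = cm ^+ 2 + 4 * (t * D))%R by rewrite /cm /cp; field; nz.
have cx0 : ((cm + cp) / (2 * D) = x0)%R by rewrite /cm /cp; field; nz.
have tD0 : (0 < t * D)%R by rewrite mulr_gt0.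
rewrite EFinD ge0_muleDl ?lee_fin ?powR_ge0//.
rewrite -!integral_sqrB_scale ?exprn_gt0// !sqrtr_sqr !gtr0_norm//.
have E1 : \int[mu]_(X in `]cm, +oo[) ((X ^+ 2 - cm ^+ 2) `^ (- 2^-1 - b))%:E =
  \int[mu]_(x in `]x0, +oo[) ((D ^+ 2 * x ^+ 2 + t ^+ 2 / x ^+ 2
       - (D ^+ 2 * x0 ^+ 2 + t ^+ 2 / x0 ^+ 2)) `^ (- 2^-1 - b)
       * (D + t / x ^+ 2))%:E.
  etransitivity.
    (* The inverse is the positive root of [D x^2 - X x - t = 0]. *)
    apply: (@ge0_integral_subst R `]x0, +oo[ `]cm, +oo[
      (fun x => D * x - t / x)%R
      (fun x => D + t / x ^+ 2)%R
      (fun X => (X + Num.sqrt (X ^+ 2 + 4 * (t * D))) / (2 * D))%R) => //.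
    - exact: interval_is_interval.
    - move=> x /=; rewrite !in_itv/= !andbT => xx0.
      have xp := pos x xx0; split.
        by rewrite /cm ltrB ?ltr_pM2l ?ltf_pV2 ?posrE.
      have -> : ((D * x - t / x) ^+ 2 + 4 * (t * D) = (D * x + t / x) ^+ 2)%R.
        by field; nz.
      rewrite sqrtr_sqr gtr0_norm; last by rewrite addr_gt0 ?mulr_gt0 ?invr_gt0.
      by field; nz.
    - move=> X /=; rewrite !in_itv/= !andbT => cX.
      have X0 := lt_trans cm0 cX.
      have X2 : (cm ^+ 2 < X ^+ 2)%R by rewrite ltr_pXn2r// nnegrE ltW.
      set S := Num.sqrt _.
      have S2 : (S ^+ 2 = X ^+ 2 + 4 * (t * D))%R by rewrite sqr_sqrtr//; nra.
      have S0 : (0 < S)%R by rewrite sqrtr_gt0; nra.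
      have cS : (cp < S)%R.
        by rewrite -(@ltr_pXn2r _ 2)// ?nnegrE ?ltW// S2 cmp ltrD2r.
      split; first by rewrite -cx0 ltr_pM2r ?invr_gt0 ?mulr_gt0// ltrD.
      have -> : (t = (S ^+ 2 - X ^+ 2) / (4 * D))%R by rewrite S2; field; nz.
      have XS : (0 < X + S)%R by rewrite addr_gt0.
      by field; nz.
    - move=> x /=; rewrite !in_itv/= !andbT => xx0; have xp := pos x xx0.
      by dereq; [nz | field; nz].
    - move=> x /=; rewrite !in_itv/= !andbT => xx0; have xp := pos x xx0.
      by dcont; nz.
    - left => x /=; rewrite !in_itv/= !andbT => xx0; have xp := pos x xx0.
      by rewrite addr_gt0// divr_gt0// exprn_gt0.
    - by mfun.
    - by move=> y _; rewrite lee_fin powR_ge0.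
  apply: eq_integral => x; rewrite inE/= in_itv/= andbT => xx0.
  have xp := pos x xx0.
  rewrite -EFinM gtr0_norm; last by rewrite addr_gt0// divr_gt0// exprn_gt0.
  by congr (_ `^ _ * _)%:E; rewrite /cm; field; nz.
have E2 : \int[mu]_(X in `]cp, +oo[) ((X ^+ 2 - cp ^+ 2) `^ (- 2^-1 - b))%:E =
  \int[mu]_(x in `]x0, +oo[) ((D ^+ 2 * x ^+ 2 + t ^+ 2 / x ^+ 2
       - (D ^+ 2 * x0 ^+ 2 + t ^+ 2 / x0 ^+ 2)) `^ (- 2^-1 - b)
       * (D - t / x ^+ 2))%:E.
  etransitivity.
    (* The inverse is the larger root of [D x^2 - X x + t = 0]. The map increases because
       [t < D x0^2] puts [x0] beyond its minimum, at [x^2 = t / D]. *)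
    apply: (@ge0_integral_subst R `]x0, +oo[ `]cp, +oo[
      (fun x => D * x + t / x)%R
      (fun x => D - t / x ^+ 2)%R
      (fun X => (X + Num.sqrt (X ^+ 2 - 4 * (t * D))) / (2 * D))%R) => //.
    - exact: interval_is_interval.
    - move=> x /=; rewrite !in_itv/= !andbT => xx0.
      have xp := pos x xx0; split.
        rewrite /cp -subr_gt0.
        have -> : (D * x + t / x - (D * x0 + t / x0) =
          (x - x0) * (D * x0 * x - t) / (x * x0))%R by field; nz.
        rewrite divr_gt0 ?mulr_gt0 ?subr_gt0//.
        by apply: (lt_trans tD); rewrite expr2 mulrA ltr_pM2l// mulr_gt0.
      have -> : ((D * x + t / x) ^+ 2 - 4 * (t * D) = (D * x - t / x) ^+ 2)%R.
        by field; nz.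
      rewrite sqrtr_sqr gtr0_norm; last first.
        by rewrite subr_gt0 ltr_pdivrMr// -mulrA -expr2 tDx.
      by field; nz.
    - move=> X /=; rewrite !in_itv/= !andbT => cX.
      have X0 := lt_trans cp0 cX.
      have X2 : (cp ^+ 2 < X ^+ 2)%R by rewrite ltr_pXn2r// nnegrE ltW.
      have cm20 : (0 < cm ^+ 2)%R by rewrite exprn_gt0.
      set S := Num.sqrt _.
      have S2 : (S ^+ 2 = X ^+ 2 - 4 * (t * D))%R by rewrite sqr_sqrtr//; lra.
      have S0 : (0 < S)%R by rewrite sqrtr_gt0; lra.
      have cS : (cm < S)%R.
        by rewrite -(@ltr_pXn2r _ 2)// ?nnegrE ?ltW// S2; lra.
      split.
        by rewrite -cx0 (addrC cm) ltr_pM2r ?invr_gt0 ?mulr_gt0// ltrD.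
      have -> : (t = (X ^+ 2 - S ^+ 2) / (4 * D))%R by rewrite S2; field; nz.
      have XS : (0 < X + S)%R by rewrite addr_gt0.
      by field; nz.
    - move=> x /=; rewrite !in_itv/= !andbT => xx0; have xp := pos x xx0.
      by dereq; [nz | field; nz].
    - move=> x /=; rewrite !in_itv/= !andbT => xx0; have xp := pos x xx0.
      by dcont; nz.
    - left => x /=; rewrite !in_itv/= !andbT => xx0; have xp := pos x xx0.
      by rewrite subr_gt0 ltr_pdivrMr ?exprn_gt0// tDx.
    - by mfun.
    - by move=> y _; rewrite lee_fin powR_ge0.
  apply: eq_integral => x; rewrite inE/= in_itv/= andbT => xx0.
  have xp := pos x xx0.
  rewrite -EFinM gtr0_norm; last first.
    by rewrite subr_gt0 ltr_pdivrMr ?exprn_gt0// tDx.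
  by congr (_ `^ _ * _)%:E; rewrite /cp; field; nz.
rewrite E1 E2 -ge0_integralD//; last 4 first.
- move=> x /=; rewrite in_itv/= andbT => /pos xp.
  by rewrite lee_fin mulr_ge0 ?powR_ge0// addr_ge0 ?divr_ge0 ?exprn_ge0 ?ltW.
- by mfun.
- move=> x /=; rewrite in_itv/= andbT => xx0; have xp := pos x xx0.
  rewrite lee_fin mulr_ge0 ?powR_ge0// subr_ge0 ler_pdivrMr ?exprn_gt0// ltW//.
  exact: tDx.
- by mfun.
by apply: eq_integral => x _; rewrite -EFinD; congr EFin; ring.
Qed.
End inner_integrals.

(** * The integral in [r] between [sqrt z] and [v] *)

Section arc_integral.
Variable R : realType.
Local Notation mu := (@lebesgue_measure R).
Local Open Scope ereal_scope.

(** With [x^2 = (1 + r) / (v - r)] the powers of [x] and [1 + x^2] cancel, leaving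
    [2 (1 + v)^(2 b) Q^(- 1/2 - b)] where [Q = D^2 x^2 + t^2 / x^2 - 2 (v + z)], [D^2 = v^2 - z] and
    [t^2 = 1 - z]. Since [Q] vanishes at the left end, [integral_two_branches] applies; its factor
    [D] accounts for the denominator [sqrt (v^2 - z)]. *)
Lemma integral_arc (b z v : R) : (0 < z)%R -> (z < 1)%R -> (Num.sqrt z < v)%R ->
  \int[mu]_(r in `](Num.sqrt z), v[)
    ((1 + r) `^ b * (v - r) `^ (b - 1) * (r ^+ 2 - z) `^ (- 2^-1 - b))%:E =
  ((1 + v) `^ (2 * b) / Num.sqrt (v ^+ 2 - z) *
   ((2 * (v + z) - 2 * Num.sqrt ((1 - z) * (v ^+ 2 - z))) `^ (- b) +
    (2 * (v + z) + 2 * Num.sqrt ((1 - z) * (v ^+ 2 - z))) `^ (- b)))%:E *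
  \int[mu]_(x in `]1%R, +oo[) ((x ^+ 2 - 1) `^ (- 2^-1 - b))%:E.
Proof.
move=> z0 z1 zv.
set th := Num.sqrt z.
have th0 : (0 < th)%R by rewrite sqrtr_gt0.
have th2 : (z = th ^+ 2)%R by rewrite sqr_sqrtr// ltW.
have thv : (th < v)%R by [].
have th1 : (th < 1)%R by rewrite -(@sqrtr1 R) ltr_sqrt.
have v0 : (0 < v)%R := lt_trans th0 thv.
have v1 : (0 < 1 + v)%R by rewrite addr_gt0.
rewrite th2; clearbody th; clear zv.
have t20 : (0 < 1 - th ^+ 2)%R by nra.
have D20 : (0 < v ^+ 2 - th ^+ 2)%R by nra.
rewrite sqrtrM ?ltW//.
have t0 : (0 < Num.sqrt (1 - th ^+ 2))%R by rewrite sqrtr_gt0.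
have D0 : (0 < Num.sqrt (v ^+ 2 - th ^+ 2))%R by rewrite sqrtr_gt0.
have t2 : (Num.sqrt (1 - th ^+ 2) ^+ 2 = 1 - th ^+ 2)%R by rewrite sqr_sqrtr// ltW.
have D2 : (Num.sqrt (v ^+ 2 - th ^+ 2) ^+ 2 = v ^+ 2 - th ^+ 2)%R.
  by rewrite sqr_sqrtr// ltW.
(* The roots become variables known only by their sign and their squares, so that the identities
   below are rational and within reach of [field]. *)
move: (Num.sqrt (1 - th ^+ 2)) (Num.sqrt (v ^+ 2 - th ^+ 2)) t0 D0 t2 D2.
move=> t D t0 D0 t2 D2.
have vth : (0 < v - th)%R by rewrite subr_gt0.
set x0 := Num.sqrt ((1 + th) / (v - th)).
have x00 : (0 < x0)%R by rewrite sqrtr_gt0 divr_gt0// addr_gt0.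
have x02 : (x0 ^+ 2 = (1 + th) / (v - th))%R.
  by rewrite sqr_sqrtr// ltW// divr_gt0// addr_gt0.
(* Squares are compared: after clearing [v - th] their difference factors into terms that are
   positive because [0 < th < v]. *)
have tDx0 : (t < D * x0 ^+ 2)%R.
  have h1 : (0 <= t * (v - th))%R by rewrite mulr_ge0 ?ltW.
  have h2 : (0 <= D * (1 + th))%R by rewrite mulr_ge0 ?ltW// addr_gt0.
  rewrite x02 mulrA ltr_pdivlMr// -(@ltr_pXn2r _ 2)//.
  rewrite !exprMn t2 D2 -subr_gt0.
  have -> : ((v ^+ 2 - th ^+ 2) * (1 + th) ^+ 2 - (1 - th ^+ 2) * (v - th) ^+ 2 =
    (v - th) * (1 + th) * (2 * th * (1 + v)))%R by ring.
  have h3 : (0 < 1 + th)%R by rewrite addr_gt0.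
  by rewrite !mulr_gt0.
(* [x0] corresponds to [r = th], so this equation says that [Q] vanishes at [x0]. *)
have K : (D ^+ 2 * x0 ^+ 2 + t ^+ 2 / x0 ^+ 2 = 2 * (v + th ^+ 2))%R.
  have h1 : (0 < 1 + th)%R by rewrite addr_gt0.
  by rewrite x02 D2 t2; field; nz.
have pos x : (x0 < x)%R -> (0 < x)%R by exact: lt_trans.
have Q0 x : (x0 < x)%R -> (th < (v * x ^+ 2 - 1) / (1 + x ^+ 2))%R.
  move=> xx0; have xp := pos x xx0.
  have x20 : (0 < x ^+ 2)%R by rewrite exprn_gt0.
  have : (x0 ^+ 2 < x ^+ 2)%R by rewrite ltr_pXn2r// nnegrE ltW.
  rewrite x02 ltr_pdivrMr// => ?; rewrite ltr_pdivlMr; nra.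
have -> : ((1 + v) `^ (2 * b) / D *
     ((2 * (v + th ^+ 2) - 2 * (t * D)) `^ (- b) +
      (2 * (v + th ^+ 2) + 2 * (t * D)) `^ (- b)) =
   (1 + v) `^ (2 * b) / D * (((D * x0 - t / x0) ^+ 2) `^ (- b) +
      ((D * x0 + t / x0) ^+ 2) `^ (- b)))%R.
  by rewrite -K; congr (_ * (_ `^ _ + _ `^ _))%R; field; nz.
rewrite EFinM -muleA -integral_two_branches//.
rewrite -ge0_integralZl_EFin//; last 3 first.
- by move=> x _; rewrite lee_fin !mulr_ge0 ?powR_ge0// ltW.
- by mfun.
- by rewrite mulr_ge0 ?powR_ge0// invr_ge0 ltW.
etransitivity.
  apply: (@ge0_integral_subst R `]x0, +oo[ `]th, v[
    (fun x => (v * x ^+ 2 - 1) / (1 + x ^+ 2))%R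
    (fun x => 2 * x * (1 + v) / (1 + x ^+ 2) ^+ 2)%R
    (fun r => Num.sqrt ((1 + r) / (v - r)))%R) => //.
  - exact: interval_is_interval.
  - move=> x /=; rewrite !in_itv/= !andbT => xx0; have xp := pos x xx0.
    have x20 : (0 < x ^+ 2)%R by rewrite exprn_gt0.
    have x21 : (0 < 1 + x ^+ 2)%R by rewrite addr_gt0.
    split; first by rewrite Q0// ltr_pdivrMr//; nra.
    have -> : ((1 + (v * x ^+ 2 - 1) / (1 + x ^+ 2)) /
      (v - (v * x ^+ 2 - 1) / (1 + x ^+ 2)) = x ^+ 2)%R by field; nz.
    by rewrite sqrtr_sqr gtr0_norm.
  - move=> r /=; rewrite !in_itv/= !andbT => /andP[thr rv].
    have r0 : (0 < 1 + r)%R by rewrite addr_gt0// (lt_trans th0).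
    have vr : (0 < v - r)%R by rewrite subr_gt0.
    split.
      rewrite ltr_sqrt ?divr_gt0// ltr_pdivrMr// mulrAC ltr_pdivlMr//; nra.
    rewrite sqr_sqrtr ?divr_ge0 ?ltW//.
    by field; nz.
  - move=> x /=; rewrite !in_itv/= !andbT => xx0; have xp := pos x xx0.
    have x20 : (0 < x ^+ 2)%R by rewrite exprn_gt0.
    have x21 : (0 < 1 + x ^+ 2)%R by rewrite addr_gt0.
    by dereq; [nz | field; nz].
  - move=> x /=; rewrite !in_itv/= !andbT => xx0; have xp := pos x xx0.
    have x20 : (0 < x ^+ 2)%R by rewrite exprn_gt0.
    have x21 : (0 < 1 + x ^+ 2)%R by rewrite addr_gt0.
    by dcont; nz.
  - left => x /=; rewrite !in_itv/= !andbT => xx0; have xp := pos x xx0.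
    have x20 : (0 < x ^+ 2)%R by rewrite exprn_gt0.
    by rewrite divr_gt0 ?mulr_gt0 ?exprn_gt0 ?addr_gt0.
  - by mfun.
  - by move=> y _; rewrite lee_fin !mulr_ge0 ?powR_ge0.
apply: eq_integral => x; rewrite inE/= in_itv/= andbT => xx0.
have xp := pos x xx0.
have x20 : (0 < x ^+ 2)%R by rewrite exprn_gt0.
have x21 : (0 < 1 + x ^+ 2)%R by rewrite addr_gt0.
rewrite -!EFinM; congr EFin.
rewrite gtr0_norm ?divr_gt0 ?mulr_gt0 ?exprn_gt0// K.
set Q := (D ^+ 2 * x ^+ 2 + t ^+ 2 / x ^+ 2 - 2 * (v + th ^+ 2))%R.
have QE : (((v * x ^+ 2 - 1) / (1 + x ^+ 2)) ^+ 2 - th ^+ 2 =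
    x ^+ 2 * Q / (1 + x ^+ 2) ^+ 2)%R.
  by rewrite /Q D2 t2; field; nz.
have Qp : (0 < Q)%R.
  have : (0 < x ^+ 2 * Q / (1 + x ^+ 2) ^+ 2)%R.
    rewrite -QE subr_gt0 ltr_pXn2r// ?nnegrE ?(ltW th0) ?Q0//.
    by rewrite ltW// (lt_trans th0)// Q0.
  by rewrite pmulr_lgt0 ?invr_gt0 ?exprn_gt0// pmulr_rgt0.
rewrite QE.
have -> : (1 + (v * x ^+ 2 - 1) / (1 + x ^+ 2) =
  x ^+ 2 * (1 + v) / (1 + x ^+ 2))%R by field; nz.
have -> : (v - (v * x ^+ 2 - 1) / (1 + x ^+ 2) = (1 + v) / (1 + x ^+ 2))%R.
  by field; nz.
have H : ((x ^+ 2 * (1 + v) / (1 + x ^+ 2)) `^ b *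
   ((1 + v) / (1 + x ^+ 2)) `^ (b - 1) *
   (x ^+ 2 * Q / (1 + x ^+ 2) ^+ 2) `^ (- 2^-1 - b) *
   (x * (1 + v) / (1 + x ^+ 2) ^+ 2) =
   (1 + v) `^ (2 * b) * Q `^ (- 2^-1 - b))%R.
  have [u1 ->] := gt0_expR x21; have [u2 ->] := gt0_expR Qp.
  by have [u3 ->] := gt0_expR xp; have [u4 ->] := gt0_expR v1; pw.
transitivity (2 * ((x ^+ 2 * (1 + v) / (1 + x ^+ 2)) `^ b *
   ((1 + v) / (1 + x ^+ 2)) `^ (b - 1) *
   (x ^+ 2 * Q / (1 + x ^+ 2) ^+ 2) `^ (- 2^-1 - b) *
   (x * (1 + v) / (1 + x ^+ 2) ^+ 2)))%R; first by ring.
by rewrite H; field; nz.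
Qed.
End arc_integral.

(** * The two-to-one substitution for [z] *)

Section fold_integral.
Variable R : realType.
Local Notation mu := (@lebesgue_measure R).
Local Open Scope ereal_scope.

Section fold.
Variables (a b v : R).
Hypotheses (v0 : (0 < v)%R) (v1 : v != 1%R).
Let p := (a + b)%R.
(** Obtained by solving [2 (v + z) -/+ 2 q z = (1 + v)^2 (1 - n^2)] for [z]: squaring removes the
    sign, so both choices lead to this one function, invariant under [n -> y / n] with the [y]
    below. *)
Let F (n : R) := ((1 + v ^+ 2) / 2 - (1 - v) ^+ 2 / (4 * n ^+ 2) -
  (1 + v) ^+ 2 * n ^+ 2 / 4)%R.
Let F' (n : R) := ((1 - v) ^+ 2 / (2 * (n * n ^+ 2)) - (1 + v) ^+ 2 * n / 2)%R.
Let q (z : R) := Num.sqrt ((1 - z) * (v ^+ 2 - z)).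
(** [e = 1] and [e = - 1] select the two summands produced by [integral_arc]. *)
Let phi (e z : R) := (z `^ (p - 1) * (1 + v) `^ (2 * b) / q z *
  (2 * (v + z) - e * (2 * q z)) `^ (- b))%R.
Let h (n : R) := ((1 - n ^+ 2) `^ (a - 1) * n `^ (1 - 2 * p) *
  ((1 + v) ^+ 2 * n ^+ 2 - (1 - v) ^+ 2) `^ (p - 1))%R.
(** The positive zero of [F] other than [1]; its square root [sy], the fixed point of [n -> y / n],
    is where [F] turns. *)
Let y := (`|1 - v| / (1 + v))%R.
Let sy := Num.sqrt y.

Let v10 : (0 < 1 + v)%R. Proof. by rewrite addr_gt0. Qed.
Let y0 : (0 < y)%R.
Proof. by rewrite divr_gt0// normr_gt0 subr_eq0 eq_sym. Qed.
Let y1 : (y < 1)%R.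
Proof. by have := v0; rewrite ltr_pdivrMr// mul1r ltr_norml => ?; apply/andP; split; lra. Qed.
Let y2 : ((1 - v) ^+ 2 = y ^+ 2 * (1 + v) ^+ 2)%R.
Proof.
by rewrite exprMn exprVn divfK ?expf_neq0 ?gt_eqF// real_normK ?num_real.
Qed.
Let sy0 : (0 < sy)%R. Proof. by rewrite sqrtr_gt0. Qed.
Let sy2 : (sy ^+ 2 = y)%R. Proof. by rewrite sqr_sqrtr// ltW. Qed.
Let sy1 : (sy < 1)%R. Proof. by rewrite -(@sqrtr1 R) ltr_sqrt. Qed.
Let ysy : (y < sy)%R.
Proof. by rewrite -{1}sy2 expr2 gtr_pMr. Qed.

(** The Jacobian cancels the denominator: [q (F n) = r] and [|F' n| = 2 r / n], with [r] as in the
    proof. The base of the power [- b] is [(1 + v)^2 (1 - n^2)] for either sign, so the result is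
    free of [e]; the last assumption selects the side of [sy] on which [r > 0]. *)
Let phi_F (e n : R) : (0 < n)%R -> (y < n)%R -> (n < 1)%R -> (e ^+ 2 = 1)%R ->
  (0 < e * (n ^+ 2 * n ^+ 2 - y ^+ 2))%R ->
  (phi e (F n) * `|F' n| = 2 * 4 `^ (1 - p) * h n)%R.
Proof.
move=> n0 yn n1 e2 en.
have n20 : (0 < n ^+ 2)%R by rewrite exprn_gt0.
have FE : (F n = (1 - n ^+ 2) * ((1 + v) ^+ 2 * n ^+ 2 - (1 - v) ^+ 2) /
   (4 * n ^+ 2))%R by rewrite /F; field; nz.
have A0 : (0 < 1 - n ^+ 2)%R by nra.
have B0 : (0 < (1 + v) ^+ 2 * n ^+ 2 - (1 - v) ^+ 2)%R.
  by rewrite y2 mulrC -mulrBl mulr_gt0 ?exprn_gt0// subr_gt0 ltr_pXn2r// nnegrE ltW.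
pose r := (e * ((1 + v) ^+ 2 * n ^+ 2 - (1 - v) ^+ 2 / n ^+ 2) / 4)%R.
have rE : (r = (1 + v) ^+ 2 * (e * (n ^+ 2 * n ^+ 2 - y ^+ 2)) / (4 * n ^+ 2))%R.
  by rewrite /r y2; field; nz.
have r0 : (0 < r)%R.
  rewrite rE; apply: divr_gt0; apply: mulr_gt0 => //; exact: exprn_gt0.
have qF : (q (F n) = r)%R.
  rewrite /q (_ : (1 - F n) * (v ^+ 2 - F n) = r ^+ 2)%R.
    by rewrite sqrtr_sqr gtr0_norm.
  rewrite /r exprMn exprMn e2 /F; field; nz.
have F'E : (`|F' n| = 2 * r / n)%R.
  have -> : (F' n = - e * (2 * r / n))%R.
    rewrite /r (_ : - e * (2 * (e * ((1 + v) ^+ 2 * n ^+ 2 - (1 - v) ^+ 2 / n ^+ 2) / 4) / n)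
     = e ^+ 2 * (- (2 * (((1 + v) ^+ 2 * n ^+ 2 - (1 - v) ^+ 2 / n ^+ 2) / 4) / n)))%R.
      by rewrite e2 /F'; field; nz.
    by field; nz.
  rewrite mulNr normrN normrM (gtr0_norm (_ : 0 < 2 * r / n)%R); last first.
    by rewrite divr_gt0// mulr_gt0.
  suff -> : (`|e| = 1)%R by rewrite mul1r.
  by apply/eqP; rewrite -(@eqrXn2 _ 2)// ?normr_ge0// real_normK ?num_real// e2 expr1n.
rewrite /phi qF F'E.
have -> : (2 * (v + F n) - e * (2 * r) = (1 + v) ^+ 2 * (1 - n ^+ 2))%R.
  rewrite /r (_ : e * (2 * (e * ((1 + v) ^+ 2 * n ^+ 2 - (1 - v) ^+ 2 / n ^+ 2) / 4))
    = e ^+ 2 * (2 * (((1 + v) ^+ 2 * n ^+ 2 - (1 - v) ^+ 2 / n ^+ 2) / 4)))%R.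
    by rewrite e2 /F; field; nz.
  by field; nz.
rewrite FE /h.
have H : (((1 - n ^+ 2) * ((1 + v) ^+ 2 * n ^+ 2 - (1 - v) ^+ 2) / (4 * n ^+ 2)) `^ (p - 1) *
   (1 + v) `^ (2 * b) / r * ((1 + v) ^+ 2 * (1 - n ^+ 2)) `^ (- b) * (r / n) =
   4 `^ (1 - p) * ((1 - n ^+ 2) `^ (a - 1) * n `^ (1 - 2 * p) *
   ((1 + v) ^+ 2 * n ^+ 2 - (1 - v) ^+ 2) `^ (p - 1)))%R.
  have [u1 ->] := gt0_expR A0; have [u2 ->] := gt0_expR B0.
  have [u3 ->] := gt0_expR r0; have [u4 ->] := gt0_expR v10.
  have [u5 ->] := gt0_expR n0.
  have [u6 ->] : exists x, (4 = expR x :> R)%R by exact: gt0_expR.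
  by rewrite /p; pw.
by rewrite -[RHS]mulrA -H; field; nz.
Qed.

Let F1 : F 1 = 0%R. Proof. by rewrite /F expr1n; field. Qed.
Let Fy : F y = 0%R. Proof. by rewrite /F (mulrC ((1 + v) ^+ 2)%R) -y2 {1}y2; field; nz. Qed.
(** Since [y (1 + v) = |1 - v|], the value is [(1 + v^2 - |1 - v^2|) / 2], the smaller of [1] and
    [v^2]. *)
Let Fsy : F sy = (Num.min 1 (v ^+ 2))%R.
Proof.
rewrite /F y2 sy2 (_ : _ - _ = (1 + v ^+ 2) / 2 - y * (1 + v) * (1 + v) / 2)%R; last first.
  by field; nz.
rewrite /y divfK ?gt_eqF//; have [v1'|v1'] := ltP v 1%R.
  by rewrite gtr0_norm ?subr_gt0// min_r ?expr_le1 ?ltW//; field.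
by rewrite ler0_norm ?subr_le0// min_l ?expr_ge1 ?(ltW v0)//; field.
Qed.
Let dF (n : R) : (0 < n)%R -> is_derive n 1%R F (F' n).
Proof. by move=> n0; rewrite /F; dereq; [nz | rewrite /F'; field; nz]. Qed.
Let cF' (n : R) : (0 < n)%R -> {for n, continuous F'}.
Proof.
by move=> n0; rewrite /F'; dcont; rewrite gt_eqF// !mulr_gt0// exprn_gt0.
Qed.
Let sF (n : R) : (0 < n)%R -> F' n = (- ((1 + v) ^+ 2 / (2 * (n * n ^+ 2))) *
  (n ^+ 2 * n ^+ 2 - y ^+ 2))%R.
Proof. by move=> n0; rewrite /F' y2; field; nz. Qed.
Let n4 (n : R) : (0 < n)%R -> (0 < n ^+ 2 * n ^+ 2 - y ^+ 2)%R = (sy < n)%R.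
Proof.
move=> n0; rewrite -expr2 subr_gt0 ltr_pXn2r// ?nnegrE ?sqr_ge0 ?ltW//.
by rewrite -sy2 ltr_pXn2r// nnegrE ltW.
Qed.
Let n4' (n : R) : (0 < n)%R -> (n ^+ 2 * n ^+ 2 - y ^+ 2 < 0)%R = (n < sy)%R.
Proof.
move=> n0; rewrite -expr2 subr_lt0 ltr_pXn2r// ?nnegrE ?sqr_ge0 ?ltW//.
by rewrite -sy2 ltr_pXn2r// nnegrE ltW.
Qed.
Let c0 (n : R) : (0 < n)%R -> (0 < (1 + v) ^+ 2 / (2 * (n * n ^+ 2)))%R.
Proof. by move=> n0; rewrite divr_gt0 ?mulr_gt0 ?exprn_gt0. Qed.
Let mphi (e : R) : measurable_fun `]0%R, (Num.min 1 (v ^+ 2))%R[%classic (EFin \o phi e).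
Proof. by rewrite /comp /phi /q; mfun. Qed.
Let phi0 (e z : R) : (0 <= phi e z)%R.
Proof. by rewrite !mulr_ge0 ?powR_ge0// invr_ge0 sqrtr_ge0. Qed.

(* [F] increases on [`]y, sy[] and decreases on [`]sy, 1[] between the same
   values; these two arcs carry the two summands of the left-hand side. *)
Lemma integral_fold :
  \int[mu]_(z in `]0%R, (Num.min 1 (v ^+ 2))%R[)
    (z `^ (a + b - 1) * (1 + v) `^ (2 * b) / Num.sqrt ((1 - z) * (v ^+ 2 - z)) *
     ((2 * (v + z) - 2 * Num.sqrt ((1 - z) * (v ^+ 2 - z))) `^ (- b) +
      (2 * (v + z) + 2 * Num.sqrt ((1 - z) * (v ^+ 2 - z))) `^ (- b)))%:E =
  \int[mu]_(n in `](`|1 - v| / (1 + v))%R, 1%R[)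
    (2 * 4 `^ (1 - (a + b)) * ((1 - n ^+ 2) `^ (a - 1) * n `^ (1 - 2 * (a + b)) *
      ((1 + v) ^+ 2 * n ^+ 2 - (1 - v) ^+ 2) `^ (a + b - 1)))%:E.
Proof.
transitivity (\int[mu]_(z in `]0%R, (Num.min 1 (v ^+ 2))%R[)
   ((phi 1 z)%:E + (phi (-1) z)%:E)).
  apply: eq_integral => z _; rewrite -EFinD /phi mul1r mulN1r opprK -/(q z).
  by congr EFin; rewrite -/p; ring.
rewrite ge0_integralD//; last 4 first.
- by move=> z _; rewrite lee_fin.
- exact: mphi.
- by move=> z _; rewrite lee_fin.
- exact: mphi.
have E1 : \int[mu]_(z in `]0%R, (Num.min 1 (v ^+ 2))%R[) (phi 1 z)%:E =
    \int[mu]_(n in `]sy, 1%R[) (2 * 4 `^ (1 - p) * h n)%:E.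
  etransitivity.
    apply: (@ge0_integral_subst_itv R sy 1 F F' (fun z => (phi 1 z)%:E)
      `]0%R, (Num.min 1 (v ^+ 2))%R[%classic sy1).
    - move=> n /andP[yn _]; exact/dF/(lt_le_trans sy0).
    - move=> n /andP[yn _]; exact/cF'/(lt_trans sy0).
    - right; split; last by rewrite F1 Fsy.
      move=> n /andP[yn _]; have n0 := lt_trans sy0 yn.
      by rewrite sF// mulNr oppr_lt0 mulr_gt0 ?c0// n4.
    - exact: mphi.
    - by move=> z _; rewrite lee_fin.
  apply: eq_integral => n; rewrite inE/= in_itv/= => /andP[yn n1].
  have n0 := lt_trans sy0 yn.
  rewrite -EFinM phi_F ?expr1n ?mul1r ?n4//.
  exact: lt_trans ysy yn.
have E2 : \int[mu]_(z in `]0%R, (Num.min 1 (v ^+ 2))%R[) (phi (-1) z)%:E =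
    \int[mu]_(n in `]y, sy[) (2 * 4 `^ (1 - p) * h n)%:E.
  etransitivity.
    apply: (@ge0_integral_subst_itv R y sy F F' (fun z => (phi (-1) z)%:E)
      `]0%R, (Num.min 1 (v ^+ 2))%R[%classic ysy).
    - move=> n /andP[yn _]; exact/dF/(lt_le_trans y0).
    - move=> n /andP[yn _]; exact/cF'/(lt_trans y0).
    - left; split; last by rewrite Fy Fsy.
      move=> n /andP[yn nsy]; have n0 := lt_trans y0 yn.
      by rewrite sF// mulNr oppr_gt0 pmulr_rlt0 ?c0// n4'.
    - exact: mphi.
    - by move=> z _; rewrite lee_fin.
  apply: eq_integral => n; rewrite inE/= in_itv/= => /andP[yn n1].
  have n0 := lt_trans y0 yn.
  rewrite -EFinM phi_F ?sqrrN ?expr1n ?mulN1r ?oppr_gt0 ?n4'//.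
  exact: lt_trans n1 sy1.
have mh (D : set R) : measurable_fun D (fun n => (2 * 4 `^ (1 - p) * h n)%:E).
  by rewrite /h; mfun.
(* The null point [sy] is added to the left arc, so that the two arcs tile []y, 1[]. *)
rewrite E1 E2 addeC (@integral_itv_bndo_bndc _ (BRight y) sy); last exact: mh.
rewrite -/y -ge0_integral_setU//=.
- congr (integral _ _ _).
  by rewrite -itv_bndbnd_setU// bnd_simp ?ltW.
- exact: mh.
- by move=> n _; rewrite lee_fin !mulr_ge0 ?powR_ge0.
- rewrite disj_set2E; apply/eqP/seteqP; split => // n [] /=.
  by rewrite !in_itv/= => /andP[_ ns] /andP[sn _]; move: (le_lt_trans ns sn); rewrite ltxx.
Qed.
End fold.
End fold_integral.

(** * The density of the sum *)

Section sum_side.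
Variable R : realType.
Local Notation mu := (@lebesgue_measure R).
Local Open Scope ereal_scope.

Lemma measurable_set_bool d (T : measurableType d) (f : T -> bool) :
  measurable_fun setT f -> measurable [set x | f x].
Proof.
by move=> mf; have := mf measurableT [set true] I; rewrite setTI.
Qed.

(** Zero extension to the plane reduces a moving domain to the measurability part of Tonelli's
    theorem. *)
Lemma measurable_fun_integral_param (A : set R) (B : R -> set R)
    (f : R -> R -> \bar R) :
  measurable A -> (forall x, A x -> measurable (B x)) ->
  measurable [set z : R * R | A z.1 /\ B z.1 z.2] ->
  measurable_fun setT (fun z : R * R => f z.1 z.2) ->
  (forall x y, A x -> B x y -> 0 <= f x y) ->
  measurable_fun A (fun x => \int[mu]_(y in B x) f x y).
Proof.
move=> mA mB mC mf f0.
pose C := [set z : R * R | A z.1 /\ B z.1 z.2].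
pose h z := ((fun z => f z.1 z.2) \_ C) z.
have mh : measurable_fun setT h.
  by apply/(measurable_restrictT _ mC); exact: measurable_funTS.
have h0 z : 0 <= h z.
  by rewrite /h patchE; case: ifPn => //; rewrite inE => -[]; exact: f0.
have := @measurable_fun_fubini_tonelli_F _ _ (measurableTypeR R)
  (measurableTypeR R) R mu h mh h0.
move=> /(measurable_funTS (D := A)); apply: eq_measurable_fun => x /set_mem Ax.
rewrite /fubini_F [RHS]integral_mkcond; apply: eq_integral => y _.
rewrite /h !patchE; congr (if _ then _ else _).
by apply/idP/idP => /set_mem h1; apply/mem_set; [case: h1 | split].
Qed.

Variables (a b : R).
Let p := (a + b)%R.
Let h (n v : R) := ((1 - n ^+ 2) `^ (a - 1) * n `^ (1 - 2 * p) *
  ((1 + v) ^+ 2 * n ^+ 2 - (1 - v) ^+ 2) `^ (p - 1))%R.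
Let CF := \int[mu]_(t in `](-1)%R, 1%R[) ((1 - t ^+ 2) `^ (p - 1))%:E.
Let S (s : R) := \int[mu]_(v in `]0%R, +oo[)
  \int[mu]_(n in `](`|1 - v| / (1 + v))%R, 1%R[)
    ((1 + v + s) `^ (- (2 * p)) * h n v)%:E.

(** In the centred variable, [x = s (1 + n) / 2], the product [(1 + x) (1 + s - x)] is
    [(1 + s / 2)^2 - (s n / 2)^2], the shape that Feynman's formula takes. *)
Let sum_density_sym (s : R) : (0 < s)%R ->
  \int[mu]_(x in `]0%R, s[)
    (x `^ (a - 1) * (s - x) `^ (a - 1) * ((1 + x) * (1 + (s - x))) `^ (- p))%:E =
  \int[mu]_(n in `](-1)%R, 1%R[) ((s / 2) `^ (2 * a - 1) * ((1 - n ^+ 2) `^ (a - 1) *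
    ((1 + s / 2) ^+ 2 - (s * n / 2) ^+ 2) `^ (- p)))%:E.
Proof.
move=> s0; have s20 : (0 < s / 2)%R by rewrite divr_gt0.
etransitivity.
  apply: (@ge0_integral_subst_itv R (-1) 1 (fun n => s * (1 + n) / 2)%R
    (fun=> s / 2)%R) => //.
  - by move=> n _; dereq; field.
  - by move=> n _; dcont.
  - left; split => //=; rewrite subrr mulr0 mul0r (_ : s * (1 + 1) / 2 = s)%R//.
    by field.
  - by mfun.
  - by move=> y _; rewrite lee_fin !mulr_ge0 ?powR_ge0.
apply: eq_integral => n; rewrite inE/= in_itv/= => /andP[n1 n2].
rewrite -EFinM gtr0_norm//; congr EFin.
have A0 : (0 < 1 + n)%R by lra.
have B0 : (0 < 1 - n)%R by lra.
have -> : ((1 + s * (1 + n) / 2) * (1 + (s - s * (1 + n) / 2)) =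
  (1 + s / 2) ^+ 2 - (s * n / 2) ^+ 2)%R by field.
have -> : (s * (1 + n) / 2 = s / 2 * (1 + n))%R by field.
have -> : (s - s / 2 * (1 + n) = s / 2 * (1 - n))%R by field.
have -> : (1 - n ^+ 2 = (1 + n) * (1 - n))%R by ring.
set X := (_ `^ (- p))%R.
have H : ((s / 2 * (1 + n)) `^ (a - 1) * (s / 2 * (1 - n)) `^ (a - 1) * (s / 2) =
  (s / 2) `^ (2 * a - 1) * ((1 + n) * (1 - n)) `^ (a - 1))%R.
  have [u1 ->] := gt0_expR A0; have [u2 ->] := gt0_expR B0.
  by have [u3 ->] := gt0_expR s20; pw.
by rewrite mulrAC H -mulrA.
Qed.

Let integral_even (g : R -> R) :
  measurable_fun setT g -> (forall n, (0 <= g n)%R) -> (forall n, g (- n)%R = g n) ->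
  \int[mu]_(n in `](-1)%R, 1%R[) (g n)%:E =
  2%:E * \int[mu]_(n in `]0%R, 1%R[) (g n)%:E.
Proof.
move=> mg g0 gN.
have mgD (D : set R) : measurable_fun D (fun n => (g n)%:E).
  by apply/measurable_EFinP; exact: measurable_funTS.
have -> : `](-1)%R, 1%R[%classic = `](-1)%R, 0%R] `|` `]0%R, 1%R[ :> set R.
  by rewrite -itv_bndbnd_setU// bnd_simp; lra.
rewrite ge0_integral_setU//=; last 3 first.
- exact: mgD.
- by move=> n _; rewrite lee_fin.
- rewrite disj_set2E; apply/eqP/seteqP; split => // n [] /=.
  by rewrite !in_itv/= => /andP[_ ns] /andP[sn _]; move: (le_lt_trans ns sn); rewrite ltxx.
rewrite -(@integral_itv_bndo_bndc _ (BRight (-1)%R) 0%R); last exact: mgD.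
rewrite ge0_integral_oppr; [|by []|exact: mgD|by move=> n _; rewrite lee_fin].
have -> : (-%R @^-1` `](-1)%R, 0%R[ : set R) = `]0%R, 1%R[%classic.
  by apply/seteqP; split => n /=; rewrite !in_itv/= => /andP[? ?]; apply/andP; split; lra.
under eq_integral do rewrite gN.
by rewrite (_ : 2 = 1 + 1)%R// EFinD ge0_muleDl ?mul1e ?lee_fin.
Qed.

(** Feynman's formula with [l = 1 + s / 2] and [m = s n / 2], followed by
    [t = (1 - v) / ((1 + v) n)]. Then [l + m t = (1 + v + s) / (1 + v)]: [n] leaves the factor that
    contains [s], and the powers of [1 + v] cancel. The ends in [v] are [t = 1] and [t = - 1]. *)
Let feynman_v (s n : R) : (0 < s)%R -> (0 < n < 1)%R ->
  (((1 + s / 2) ^+ 2 - (s * n / 2) ^+ 2) `^ (- p))%:E * CF =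
  \int[mu]_(v in `]((1 - n) / (1 + n))%R, ((1 + n) / (1 - n))%R[)
    (2 * ((1 + v + s) `^ (- (2 * p)) * (n `^ (1 - 2 * p) *
      ((1 + v) ^+ 2 * n ^+ 2 - (1 - v) ^+ 2) `^ (p - 1))))%:E.
Proof.
move=> s0 /andP[n0 n1].
have n1' : (0 < 1 - n)%R by rewrite subr_gt0.
have n2' : (0 < 1 + n)%R by rewrite addr_gt0.
have u0 : (0 < (1 - n) / (1 + n))%R by rewrite divr_gt0.
rewrite -feynman_parameter; last by rewrite gtr0_norm; nra.
etransitivity.
  apply: (@ge0_integral_subst_itv R ((1 - n) / (1 + n))%R ((1 + n) / (1 - n))%R
    (fun v => (1 - v) / ((1 + v) * n))%R
    (fun v => - 2 / ((1 + v) ^+ 2 * n))%R) => //.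
  - by rewrite ltr_pdivrMr// mulrAC ltr_pdivlMr//; nra.
  - move=> v /andP[uv _]; have v10 : (0 < 1 + v)%R by rewrite addr_gt0// (lt_le_trans u0).
    by dereq; [rewrite gt_eqF ?mulr_gt0 | field; nz].
  - move=> v /andP[uv _]; have v10 : (0 < 1 + v)%R by rewrite addr_gt0// (lt_trans u0).
    by dcont; rewrite gt_eqF ?mulr_gt0 ?exprn_gt0.
  - right; split.
      move=> v /andP[uv _]; have v10 : (0 < 1 + v)%R by rewrite addr_gt0// (lt_trans u0).
      by rewrite mulNr oppr_lt0 divr_gt0 ?mulr_gt0 ?exprn_gt0.
    rewrite (_ : (1 - (1 + n) / (1 - n)) / ((1 + (1 + n) / (1 - n)) * n) = -1)%R.
      by rewrite (_ : (1 - (1 - n) / (1 + n)) / ((1 + (1 - n) / (1 + n)) * n) = 1)%R//;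
        field; nz.
    by field; nz.
  - by mfun.
  - by move=> y _; rewrite lee_fin !mulr_ge0 ?powR_ge0.
apply: eq_integral => v; rewrite inE/= in_itv/= => /andP[uv vw].
have v0 := lt_trans u0 uv.
have v10 : (0 < 1 + v)%R by rewrite addr_gt0.
have vs0 : (0 < 1 + v + s)%R by rewrite addr_gt0.
rewrite -EFinM mulNr normrN gtr0_norm ?divr_gt0 ?mulr_gt0 ?exprn_gt0//; congr EFin.
have B0 : (0 < (1 + v) ^+ 2 * n ^+ 2 - (1 - v) ^+ 2)%R.
  move: uv vw; rewrite ltr_pdivrMr// ltr_pdivlMr// => uv vw.
  have -> : ((1 + v) ^+ 2 * n ^+ 2 - (1 - v) ^+ 2 =
    (v * (1 + n) - (1 - n)) * ((1 + n) - v * (1 - n)))%R by ring.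
  by rewrite mulr_gt0// subr_gt0.
have -> : (1 - ((1 - v) / ((1 + v) * n)) ^+ 2 =
  ((1 + v) ^+ 2 * n ^+ 2 - (1 - v) ^+ 2) / ((1 + v) ^+ 2 * n ^+ 2))%R by field; nz.
have -> : (1 + s / 2 + s * n / 2 * ((1 - v) / ((1 + v) * n)) = (1 + v + s) / (1 + v))%R.
  by field; nz.
have H : ((((1 + v) ^+ 2 * n ^+ 2 - (1 - v) ^+ 2) / ((1 + v) ^+ 2 * n ^+ 2)) `^ (p - 1) *
  ((1 + v + s) / (1 + v)) `^ (- (2 * p)) * ((1 + v) ^+ 2 * n)^-1 =
  (1 + v + s) `^ (- (2 * p)) * (n `^ (1 - 2 * p) *
    ((1 + v) ^+ 2 * n ^+ 2 - (1 - v) ^+ 2) `^ (p - 1)))%R.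
  have [u1 ->] := gt0_expR B0; have [u2 ->] := gt0_expR vs0.
  by have [u3 ->] := gt0_expR v10; have [u4 ->] := gt0_expR n0; pw.
by rewrite -H; ring.
Qed.

(** The [4] is a [2] from evenness in [n] times the [2] of [feynman_v]. Multiplying by [CF] is what
    lets Feynman's formula be applied under the integral in [n]. *)
Lemma sum_density (s : R) : (0 < s)%R ->
  CF * \int[mu]_(x in `]0%R, s[)
    (x `^ (a - 1) * (s - x) `^ (a - 1) * ((1 + x) * (1 + (s - x))) `^ (- p))%:E =
  (4 * (s / 2) `^ (2 * a - 1))%:E * S s.
Proof.
move=> s0; have CF0 : 0 <= CF by apply: integral_ge0 => t _; rewrite lee_fin powR_ge0.
rewrite sum_density_sym//.
under eq_integral do rewrite EFinM.
rewrite ge0_integralZl_EFin//; [|by move=> n _; rewrite lee_fin mulr_ge0 ?powR_ge0|by mfun|exact: powR_ge0].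
rewrite integral_even//; last 3 first.
- by mfun.
- by move=> n; rewrite mulr_ge0 ?powR_ge0.
- by move=> n; rewrite sqrrN mulrN mulNr sqrrN.
rewrite muleCA (muleCA CF) -ge0_integralZl//; last 2 first.
- by mfun.
- by move=> n _; rewrite lee_fin mulr_ge0 ?powR_ge0.
rewrite (_ : \int[mu]_(n in _) _ = \int[mu]_(n in `]0%R, 1%R[)
   \int[mu]_(v in `]((1 - n) / (1 + n))%R, ((1 + n) / (1 - n))%R[)
    (2 * ((1 + v + s) `^ (- (2 * p)) * h n v))%:E); last first.
  apply: eq_integral => n; rewrite inE/= in_itv/= => n01.
  rewrite EFinM muleCA (muleC CF) feynman_v// -ge0_integralZl_EFin//; last 3 first.
  - by move=> v _; rewrite lee_fin !mulr_ge0 ?powR_ge0.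
  - by mfun.
  - exact: powR_ge0.
  by apply: eq_integral => v _; rewrite -EFinM; congr EFin; rewrite /h; ring.
(* For [0 < n < 1] the bounds on [v] amount to [|1 - v| < n (1 + v)]; solved for [n], this is the
   other slicing. *)
rewrite (@ge0_tonelli_set R `]0%R, 1%R[ `]0%R, +oo[
  (fun n => `]((1 - n) / (1 + n))%R, ((1 + n) / (1 - n))%R[%classic)
  (fun v => `](`|1 - v| / (1 + v))%R, 1%R[%classic))//; last 4 first.
- move=> n v /=; rewrite !in_itv/= !andbT; split.
    move=> [/andP[n0 n1] /andP[nv vn]].
    have n1' : (0 < 1 - n)%R by rewrite subr_gt0.
    have n2' : (0 < 1 + n)%R by rewrite addr_gt0.
    have v0 : (0 < v)%R by apply: lt_trans nv; rewrite divr_gt0.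
    split => //; rewrite n1 andbT ltr_pdivrMr ?addr_gt0//.
    move: nv vn; rewrite ltr_pdivrMr// ltr_pdivlMr// => nv vn.
    by rewrite ltr_norml; apply/andP; split; nra.
  move=> [v0 /andP[vn n1]].
  have n0 : (0 < n)%R by apply: le_lt_trans vn; rewrite divr_ge0// ?addr_ge0 ?ltW.
  have n1' : (0 < 1 - n)%R by rewrite subr_gt0.
  have n2' : (0 < 1 + n)%R by rewrite addr_gt0.
  split; first by rewrite n0.
  move: vn; rewrite ltr_pdivrMr ?addr_gt0// ltr_norml => /andP[vn nv].
  by rewrite ltr_pdivrMr// ltr_pdivlMr//; apply/andP; split; nra.
- rewrite (_ : [set z | _] = [set z : R * R | (((0 < z.1) && (z.1 < 1)) &&
    (((1 - z.1) / (1 + z.1) < z.2) && (z.2 < (1 + z.1) / (1 - z.1))))%R]).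
    apply: measurable_set_bool; apply: measurable_and; apply: measurable_and;
      by apply: measurable_fun_ltr; mfun.
  by apply/seteqP; split => z /=; rewrite !in_itv/= => /andP.
- by rewrite /h; mfun.
- by move=> n v _ _; rewrite lee_fin !mulr_ge0 ?powR_ge0.
rewrite (_ : \int[mu]_(v in _) _ = 2%:E * S s).
  by rewrite !muleA -!EFinM; congr (_%:E * _); ring.
rewrite /S -ge0_integralZl_EFin//; last 2 first.
- by move=> v _; apply: integral_ge0 => n _; rewrite lee_fin mulr_ge0 ?powR_ge0// !mulr_ge0 ?powR_ge0.
- apply: measurable_fun_integral_param => //.
  + rewrite (_ : [set z | _] = [set z : R * R | ((0 < z.1) &&
      ((`|1 - z.1| / (1 + z.1) < z.2) && (z.2 < 1)))%R]).
      apply: measurable_set_bool; apply: measurable_and; last apply: measurable_and;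
        by apply: measurable_fun_ltr; mfun.
    apply/seteqP; split => z /=; rewrite !in_itv/= andbT; first by move=> [-> ->].
    by move=> /andP.
  + by rewrite /h; mfun.
  + by move=> v n _ _; rewrite lee_fin mulr_ge0 ?powR_ge0// !mulr_ge0 ?powR_ge0.
apply: eq_integral => v _; rewrite -ge0_integralZl_EFin//; last 2 first.
- by move=> n _; rewrite lee_fin mulr_ge0 ?powR_ge0// !mulr_ge0 ?powR_ge0.
- by rewrite /h; mfun.
Qed.
End sum_side.

(** * The density of the product *)

Section product_side.
Variable R : realType.
Local Notation mu := (@lebesgue_measure R).
Local Open Scope ereal_scope.

Variables (a b : R).
Let p := (a + b)%R.
Let h (n v : R) := ((1 - n ^+ 2) `^ (a - 1) * n `^ (1 - 2 * p) *
  ((1 + v) ^+ 2 * n ^+ 2 - (1 - v) ^+ 2) `^ (p - 1))%R.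
Let C1 := \int[mu]_(y in `]0%R, +oo[)
  (y `^ (2 * p - b - 1) * (1 + y) `^ (- (2 * p)))%:E.
Let C2 := \int[mu]_(x in `]1%R, +oo[) ((x ^+ 2 - 1) `^ (- 2^-1 - b))%:E.
Let S (s : R) := \int[mu]_(v in `]0%R, +oo[)
  \int[mu]_(n in `](`|1 - v| / (1 + v))%R, 1%R[)
    ((1 + v + s) `^ (- (2 * p)) * h n v)%:E.
(** The factor in front of [C2] in [integral_arc]. *)
Let J (z v : R) := ((1 + v) `^ (2 * b) / Num.sqrt (v ^+ 2 - z) *
   ((2 * (v + z) - 2 * Num.sqrt ((1 - z) * (v ^+ 2 - z))) `^ (- b) +
    (2 * (v + z) + 2 * Num.sqrt ((1 - z) * (v ^+ 2 - z))) `^ (- b)))%R.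

Let C10 : 0 <= C1.
Proof. by apply: integral_ge0 => y _; rewrite lee_fin mulr_ge0 ?powR_ge0. Qed.
Let C20 : 0 <= C2.
Proof. by apply: integral_ge0 => y _; rewrite lee_fin powR_ge0. Qed.
Let J0 z v : (0 <= J z v)%R.
Proof.
by rewrite mulr_ge0// ?addr_ge0 ?mulr_ge0 ?powR_ge0// invr_ge0 sqrtr_ge0.
Qed.

(** Multiplying by [C1] lets [(1 + r + s)^(b - 2 p)] be replaced by an integral over [v > r]. With
    [v] moved outside, [r] runs from [sqrt z] to [v], and [integral_arc] trades [C1] for [C2]. *)
Let product_w (s z : R) : (0 < s)%R -> (0 < z < 1)%R ->
  C1 * \int[mu]_(w in `]0%R, 1%R[) (w `^ (b - 1) * (1 - w) `^ (- 2^-1 - b) *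
    ((1 + Num.sqrt (z / w)) `^ b * (1 + Num.sqrt (z / w) + s) `^ (b - 2 * p)))%:E =
  C2 * \int[mu]_(v in `](Num.sqrt z), +oo[)
    (2 * z `^ b * (1 + v + s) `^ (- (2 * p)) * J z v)%:E.
Proof.
move=> s0 /andP[z0 z1].
have sz : (0 < Num.sqrt z)%R by rewrite sqrtr_gt0.
rewrite (@integral_beta_sqrt_ratio R b z
  (fun r => (1 + r) `^ b * (1 + r + s) `^ (b - 2 * p)))%R//; last 2 first.
- by mfun.
- by move=> x; rewrite mulr_ge0 ?powR_ge0.
rewrite -ge0_integralZl//; last 2 first.
- by mfun.
- by move=> r _; rewrite lee_fin !mulr_ge0 ?powR_ge0.
transitivity (\int[mu]_(r in `](Num.sqrt z), +oo[)
   \int[mu]_(v in `]r, +oo[) (2 * z `^ b * (1 + v + s) `^ (- (2 * p)) *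
    ((1 + r) `^ b * (v - r) `^ (b - 1) * (r ^+ 2 - z) `^ (- 2^-1 - b)))%:E).
  apply: eq_integral => r; rewrite inE/= in_itv/= andbT => zr.
  have r0 := lt_trans sz zr.
  have rk : (0 < r + (1 + s))%R by rewrite !addr_gt0.
  have := @integral_frac_pow R b (2 * p) r (1 + s) rk.
  rewrite -/C1 (_ : r + (1 + s) = 1 + r + s)%R; last by ring.
  move=> E1 /=; set A := (2 * z `^ b * (r ^+ 2 - z) `^ (- 2^-1 - b))%R.
  rewrite (_ : A * _ = A * (1 + r) `^ b * (1 + r + s) `^ (b - 2 * p))%R; last by ring.
  rewrite EFinM muleCA (muleC C1) -E1 -ge0_integralZl_EFin; last 4 first.
  - exact: measurable_itv.
  - by move=> v _; rewrite lee_fin mulr_ge0 ?powR_ge0.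
  - by mfun.
  - by rewrite /A !mulr_ge0 ?powR_ge0.
  apply: eq_integral => v _; rewrite -EFinM; congr EFin.
  by rewrite (_ : v + (1 + s) = 1 + v + s)%R ?/A; ring.
rewrite (@ge0_tonelli_set R `](Num.sqrt z), +oo[ `](Num.sqrt z), +oo[
  (fun r => `]r, +oo[%classic) (fun v => `](Num.sqrt z), v[%classic))//; last 4 first.
- move=> r v /=; rewrite !in_itv/= !andbT; split.
    by move=> [zr rv]; rewrite zr rv (lt_trans zr).
  by move=> [zv /andP[-> ->]].
- rewrite (_ : [set z | _] = [set z0 : R * R | ((Num.sqrt z < z0.1) && (z0.1 < z0.2))%R]).
    by apply: measurable_set_bool; apply: measurable_and; apply: measurable_fun_ltr; mfun.
  by apply/seteqP; split => y /=; rewrite !in_itv/= !andbT; [move=> [-> ->]|move=> /andP].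
- by mfun.
- by move=> n v _ _; rewrite lee_fin !mulr_ge0 ?powR_ge0.
rewrite -ge0_integralZl//; last 2 first.
- by rewrite /J; mfun.
- by move=> v _; rewrite lee_fin mulr_ge0// !mulr_ge0 ?powR_ge0.
apply: eq_integral => v; rewrite inE/= in_itv/= andbT => zv.
under eq_integral do rewrite EFinM.
rewrite ge0_integralZl_EFin//; last 3 first.
- by move=> r _; rewrite lee_fin !mulr_ge0 ?powR_ge0.
- by mfun.
- by rewrite !mulr_ge0 ?powR_ge0.
by rewrite integral_arc// -/C2 -/(J z v) muleA -EFinM muleC.
Qed.

Let M (s z v : R) := (z `^ (a - 1) * (1 - z) `^ (- 2^-1) *
  (2 * z `^ b * (1 + v + s) `^ (- (2 * p)) * J z v))%R.

Let M0 s z v : (0 <= M s z v)%R.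
Proof. by rewrite /M mulr_ge0// mulr_ge0 ?powR_ge0// !mulr_ge0 ?powR_ge0. Qed.

(** [z^(a - 1) z^b] is [z^(p - 1)], and the factor [(1 - z)^(- 1/2)] of the beta law [(a, 1/2)]
    joins [1 / sqrt (v^2 - z)] to form the denominator in [integral_fold]. *)
Let product_z (s v : R) : (0 < s)%R -> (0 < v)%R -> v != 1%R ->
  \int[mu]_(z in `]0%R, (Num.min 1 (v ^+ 2))%R[) (M s z v)%:E =
  \int[mu]_(n in `](`|1 - v| / (1 + v))%R, 1%R[)
    (4 * 4 `^ (1 - p) * ((1 + v + s) `^ (- (2 * p)) * h n v))%:E.
Proof.
move=> s0 v0 v1.
transitivity ((2 * (1 + v + s) `^ (- (2 * p)))%:E *
  \int[mu]_(z in `]0%R, (Num.min 1 (v ^+ 2))%R[)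
    (z `^ (a + b - 1) * (1 + v) `^ (2 * b) / Num.sqrt ((1 - z) * (v ^+ 2 - z)) *
     ((2 * (v + z) - 2 * Num.sqrt ((1 - z) * (v ^+ 2 - z))) `^ (- b) +
      (2 * (v + z) + 2 * Num.sqrt ((1 - z) * (v ^+ 2 - z))) `^ (- b)))%:E).
  rewrite -ge0_integralZl_EFin//; last 3 first.
  - by move=> z _; rewrite lee_fin; repeat first [exact: powR_ge0 |
      apply: mulr_ge0 | apply: addr_ge0 | rewrite invr_ge0; exact: sqrtr_ge0].
  - by mfun.
  - by rewrite mulr_ge0 ?powR_ge0.
  apply: eq_integral => z; rewrite inE/= in_itv/= lt_min => /andP[z0 /andP[z1 zv]].
  rewrite -EFinM; congr EFin; rewrite /M /J.
  have t0 : (0 < 1 - z)%R by rewrite subr_gt0.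
  have zE : (z `^ (a - 1) * z `^ b = z `^ (a + b - 1))%R.
    by have [u ->] := gt0_expR z0; pw.
  have tE : ((1 - z) `^ (- 2^-1) = (Num.sqrt (1 - z))^-1)%R.
    by rewrite powRN powR12_sqrt// ltW.
  set X := ((_ `^ (- b)) + _)%R.
  rewrite sqrtrM ?ltW// invfM -zE tE; ring.
rewrite integral_fold// -ge0_integralZl_EFin//; last 3 first.
- by move=> n _; rewrite lee_fin !mulr_ge0 ?powR_ge0.
- by mfun.
- by rewrite mulr_ge0 ?powR_ge0.
by apply: eq_integral => n _; rewrite -EFinM; congr EFin; rewrite /h /p; ring.
Qed.

Let mC : measurable [set z : R * R | `]0%R, +oo[%classic z.1 /\
   `](`|1 - z.1| / (1 + z.1))%R, 1%R[%classic z.2].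
Proof.
rewrite (_ : [set z | _] = [set z : R * R | ((0 < z.1) &&
  ((`|1 - z.1| / (1 + z.1) < z.2) && (z.2 < 1)))%R]).
  apply: measurable_set_bool; apply: measurable_and; last apply: measurable_and;
    by apply: measurable_fun_ltr; mfun.
apply/seteqP; split => z /=; rewrite !in_itv/= andbT; first by move=> [-> ->].
by move=> /andP.
Qed.

Let mC' : measurable [set z : R * R | `]0%R, +oo[%classic z.1 /\
   `]0%R, (Num.min 1 (z.1 ^+ 2))%R[%classic z.2].
Proof.
rewrite (_ : [set z | _] = [set z : R * R | ((0 < z.1) &&
  ((0 < z.2) && ((z.2 < 1) && (z.2 < z.1 ^+ 2))))%R]).
  apply: measurable_set_bool; apply: measurable_and; last apply: measurable_and;
    last apply: measurable_and; by apply: measurable_fun_ltr; mfun.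
apply/seteqP; split => z /=; rewrite !in_itv/= andbT lt_min; first by move=> [-> ->].
by move=> /andP.
Qed.

Lemma product_density (s : R) : (0 < s)%R ->
  C1 * \int[mu]_(z in `]0%R, 1%R[) \int[mu]_(w in `]0%R, 1%R[)
    (z `^ (a - 1) * (1 - z) `^ (- 2^-1) * (w `^ (b - 1) * (1 - w) `^ (- 2^-1 - b) *
    ((1 + Num.sqrt (z / w)) `^ b * (1 + Num.sqrt (z / w) + s) `^ (b - 2 * p))))%:E =
  C2 * (4 * 4 `^ (1 - p))%:E * S s.
Proof.
move=> s0.
rewrite -ge0_integralZl//; last 2 first.
- apply: measurable_fun_integral_param => //.
  + rewrite (_ : [set z | _] = [set z : R * R | (((0 < z.1) && (z.1 < 1)) &&
      ((0 < z.2) && (z.2 < 1)))%R]).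
      by apply: measurable_set_bool; apply: measurable_and; apply: measurable_and;
        apply: measurable_fun_ltr; mfun.
    by apply/seteqP; split => z /=; rewrite !in_itv/= => /andP.
  + by mfun.
  + by move=> z w _ _; rewrite lee_fin !mulr_ge0 ?powR_ge0.
- move=> z _; apply: integral_ge0 => w _.
  by rewrite lee_fin !mulr_ge0 ?powR_ge0.
transitivity (\int[mu]_(z in `]0%R, 1%R[) (C2 *
   \int[mu]_(v in `](Num.sqrt z), +oo[) (M s z v)%:E)).
  apply: eq_integral => z; rewrite inE/= in_itv/= => z01.
  under eq_integral do rewrite EFinM.
  rewrite ge0_integralZl_EFin//; last 3 first.
  - by move=> w _; rewrite lee_fin !mulr_ge0 ?powR_ge0.
  - by mfun.
  - by rewrite !mulr_ge0 ?powR_ge0.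
  rewrite muleCA product_w// muleCA -ge0_integralZl_EFin//.
  - by move=> v _; rewrite lee_fin mulr_ge0// !mulr_ge0 ?powR_ge0.
  - by rewrite /J; mfun.
  - by rewrite !mulr_ge0 ?powR_ge0.
rewrite ge0_integralZl; last 4 first.
- exact: measurable_itv.
- apply: measurable_fun_integral_param => //.
  + rewrite (_ : [set z | _] = [set z : R * R | (((0 < z.1) && (z.1 < 1)) &&
      (Num.sqrt z.1 < z.2))%R]).
      by apply: measurable_set_bool; apply: measurable_and; first apply: measurable_and;
        apply: measurable_fun_ltr; mfun.
    by apply/seteqP; split => z /=; rewrite !in_itv/= andbT => /andP.
  + by rewrite /M /J; mfun.
  + by move=> z w _ _; rewrite lee_fin.
- by move=> z _; apply: integral_ge0 => w _; rewrite lee_fin.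
- exact: C20.
rewrite -muleA; congr (_ * _).
(* Given [0 < z], the conditions [z < 1] and [sqrt z < v] together bound [z] by the minimum of [1]
   and [v^2]. *)
rewrite (@ge0_tonelli_set R `]0%R, 1%R[ `]0%R, +oo[
  (fun z => `](Num.sqrt z), +oo[%classic)
  (fun v => `]0%R, (Num.min 1 (v ^+ 2))%R[%classic))//; last 4 first.
- move=> z v /=; rewrite !in_itv/= !andbT lt_min; split.
    move=> [/andP[z0 z1] zv].
    have v0 : (0 < v)%R by apply: le_lt_trans zv; exact: sqrtr_ge0.
    split => //; rewrite z0 z1/=.
    by rewrite -[ltLHS](@sqr_sqrtr _ z) ?ltW// ltr_pXn2r// nnegrE ?sqrtr_ge0// ltW.
  move=> [v0 /andP[z0 /andP[z1 zv]]]; rewrite z0 z1; split => //.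
  by rewrite -[ltRHS]gtr0_norm// -sqrtr_sqr ltr_sqrt// exprn_gt0.
- rewrite (_ : [set z | _] = [set z : R * R | (((0 < z.1) && (z.1 < 1)) &&
    (Num.sqrt z.1 < z.2))%R]).
    by apply: measurable_set_bool; apply: measurable_and; first apply: measurable_and;
      apply: measurable_fun_ltr; mfun.
  by apply/seteqP; split => z /=; rewrite !in_itv/= andbT => /andP.
- by rewrite /M /J; mfun.
- by move=> z w _ _; rewrite lee_fin.
rewrite /S -ge0_integralZl_EFin//; last 2 first.
- by move=> v _; apply: integral_ge0 => n _; rewrite lee_fin mulr_ge0 ?powR_ge0// !mulr_ge0 ?powR_ge0.
- apply: measurable_fun_integral_param => //.
  + by rewrite /h; mfun.
  + by move=> v n _ _; rewrite lee_fin mulr_ge0 ?powR_ge0// !mulr_ge0 ?powR_ge0.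
(* At [v = 1] the fold degenerates, with [y = 0]; this null point is dropped from both integrals
   before [product_z] is used. *)
have m1 : measurable (`]0%R, +oo[ `\ (1%R : R)).
  by apply: measurableD => //; exact: measurable_set1.
rewrite -(@integral_setD1 _ _ 1%R)//; last first.
  apply: measurable_funS (measurable_fun_integral_param _ _ mC' _ _) => //.
  + by rewrite /M /J; mfun.
  + by move=> v n _ _; rewrite lee_fin.
have m2 : measurable_fun (`]0%R, +oo[ `\ (1%R : R)) (fun v : R =>
    (4 * 4 `^ (1 - p))%:E * \int[mu]_(n in `](`|1 - v| / (1 + v))%R, 1%R[)
      ((1 + v + s) `^ (- (2 * p)) * h n v)%:E).
  apply: emeasurable_funM => //.
  apply: measurable_funS (measurable_fun_integral_param _ _ mC _ _) => //.
  + by rewrite /h; mfun.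
  + by move=> v n _ _; rewrite lee_fin mulr_ge0 ?powR_ge0// !mulr_ge0 ?powR_ge0.
rewrite -[RHS](@integral_setD1 _ _ 1%R)//.
apply: eq_integral => v; rewrite inE/= in_itv/= andbT => -[v0 /eqP v1].
rewrite product_z// -ge0_integralZl_EFin//.
- by move=> n _; rewrite lee_fin mulr_ge0 ?powR_ge0// !mulr_ge0 ?powR_ge0.
- by rewrite /h; mfun.
Qed.
End product_side.

(** * Joint laws and product measures *)

Section pushforward_measure.
Context d d1 (T : measurableType d) (T1 : measurableType d1) (R : realType).
Local Open Scope ereal_scope.

Lemma pushforward_ex (P : {measure set T -> \bar R}) (X : T -> T1) :
  measurable_fun setT X ->
  exists n : {measure set T1 -> \bar R}, forall A, n A = P (X @^-1` A).
Proof.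
move=> mX; pose n : {measure set T1 -> \bar R} := pushforward P X.
by exists (n mX).
Qed.
End pushforward_measure.

Section joint_law.
Context d d1 d2 (T : measurableType d) (T1 : measurableType d1)
  (T2 : measurableType d2) (R : realType).
Local Open Scope ereal_scope.

(** Rectangles form a pi-system that generates the product sigma-algebra and contains the whole
    space, of finite mass. A finite measure and general spaces are allowed because [product_law]
    applies this to [Q] restricted to an event, and to a pair of variables. *)
Lemma joint_density (P : {measure set T -> \bar R})
    (m1 : {sigma_finite_measure set T1 -> \bar R})
    (m2 : {sigma_finite_measure set T2 -> \bar R})
    (X : T -> T1) (Y : T -> T2) (f1 : T1 -> R) (f2 : T2 -> R) :
  P setT < +oo ->
  measurable_fun setT X -> measurable_fun setT Y ->
  measurable_fun setT f1 -> (forall x, (0 <= f1 x)%R) ->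
  measurable_fun setT f2 -> (forall x, (0 <= f2 x)%R) ->
  (forall A B, measurable A -> measurable B ->
    P (X @^-1` A `&` Y @^-1` B) =
    (\int[m1]_(x in A) (f1 x)%:E) * (\int[m2]_(y in B) (f2 y)%:E)) ->
  forall C : set (T1 * T2), measurable C ->
  P [set w | C (X w, Y w)] =
  \int[m1 \x m2]_(z in C) (f1 z.1 * f2 z.2)%:E.
Proof.
move=> Pfin mX mY mf1 f10 mf2 f20 PXY C mC.
have mXY : measurable_fun setT (fun w => (X w, Y w)) by exact: measurable_fun_pair.
have [n1 n1E] := pushforward_ex P mXY.
have mf : measurable_fun setT (fun z : T1 * T2 => (f1 z.1 * f2 z.2)%R).
  by apply: measurable_funM; [exact: (measurableT_comp mf1 measurable_fst) |
    exact: (measurableT_comp mf2 measurable_snd)].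
have f0 (z : T1 * T2) : (0 <= f1 z.1 * f2 z.2)%R by rewrite mulr_ge0.
have [nu nuE] := density_measure (m1 \x m2) mf f0.
rewrite -nuE.
pose G : set (set (T1 * T2)) :=
  [set C | exists A, measurable A /\ exists B, measurable B /\ C = A `*` B].
rewrite -[LHS]n1E.
apply: (@measure_unique _ _ _ G (fun=> setT) _ _ _ _ n1 nu) => //.
- rewrite measurable_prod_measurableType //; congr (<<s _ >>).
  rewrite predeqE; split => [[A mA [B mB <-]]|[A [mA [B [mB ->]]]]].
    by exists A; split => //; exists B.
  by exists A => //; exists B.
- move=> /= _ _ [A1 [mA1 [A2 [mA2 ->]]]] [B1 [mB1 [B2 [mB2 ->]]]].
  rewrite -setXI; exists (A1 `&` B1); split; first exact: measurableI.
  by exists (A2 `&` B2); split => //; exact: measurableI.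
- move=> n; exists setT; split => //; exists setT; split => //.
  by rewrite setXTT.
- by rewrite bigcup_const//.
- move=> _ [A [mA [B [mB ->]]]].
  transitivity (P (X @^-1` A `&` Y @^-1` B)); first by rewrite n1E.
  rewrite PXY// nuE integral_mkcond.
  pose g z := (f1 z.1 * \1_A z.1)%:E * (f2 z.2 * \1_B z.2)%:E : \bar R.
  transitivity (\int[m1 \x m2]_z g z); last first.
    apply: eq_integral => -[x y] _; rewrite /g patchE/= !indicE -EFinM.
    have [xA|xA] := boolP (x \in A); have [yB|yB] := boolP (y \in B).
    + rewrite ifT ?mulr1//; rewrite inE in xA; rewrite inE in yB.
      by rewrite inE.
    + rewrite ifF ?mulr0//; apply/negP => /set_mem[_ /= /mem_set].
      by rewrite (negbTE yB).
    + rewrite ifF ?mulr0 ?mul0r//; apply/negP => /set_mem[/= /mem_set].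
      by rewrite (negbTE xA).
    + rewrite ifF ?mulr0 ?mul0r//; apply/negP => /set_mem[/= /mem_set].
      by rewrite (negbTE xA).
  have mg1 : measurable_fun setT (fun x => (f1 x * \1_A x)%:E).
    by apply/measurable_EFinP/measurable_funM => //; exact: measurable_indic.
  have mg2 : measurable_fun setT (fun x => (f2 x * \1_B x)%:E).
    by apply/measurable_EFinP/measurable_funM => //; exact: measurable_indic.
  have g10 x : 0 <= (f1 x * \1_A x)%:E by rewrite lee_fin mulr_ge0.
  have g20 x : 0 <= (f2 x * \1_B x)%:E by rewrite lee_fin mulr_ge0.
  rewrite fubini_tonelli1//; last 2 first.
  - by apply: emeasurable_funM; [exact: (measurableT_comp mg1 measurable_fst) |
      exact: (measurableT_comp mg2 measurable_snd)].
  - by move=> z; rewrite /g mule_ge0.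
  transitivity (\int[m1]_x ((f1 x * \1_A x)%:E * \int[m2]_y (f2 y * \1_B y)%:E));
    last by apply: eq_integral => x _; rewrite -ge0_integralZl.
  rewrite ge0_integralZr//; last by apply: integral_ge0.
  by congr (_ * _); rewrite [LHS]integral_mkcond; apply: eq_integral => x _;
    rewrite patchE indicE; case: ifPn; rewrite ?mulr1 ?mulr0.
- by move=> _; rewrite n1E preimage_setT.
Qed.
End joint_law.

Section product_sigma_finite.
Context d1 d2 (T1 : measurableType d1) (T2 : measurableType d2) (R : realType).
Variables (m1 : {sigma_finite_measure set T1 -> \bar R})
  (m2 : {sigma_finite_measure set T2 -> \bar R}).
Local Open Scope ereal_scope.

Let product_sigma_finite_proof : sigma_finite setT (m1 \x m2).
Proof.
have [F FT Ff] := sigma_finiteT m1; have [G GT Gf] := sigma_finiteT m2.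
exists (fun k => if @unpickle (nat * nat)%type k is Some (i, j) then F i `*` G j
  else set0).
  apply/seteqP; split => // -[x y] _.
  have [i _ Fx] : (\bigcup_i F i) x by rewrite -FT.
  have [j _ Gy] : (\bigcup_i G i) y by rewrite -GT.
  by exists (pickle (i, j)); [exact: I | rewrite pickleK].
move=> k; case: unpickle => [[i j]|]; last by rewrite measure0 ltry.
have [mF Fi] := Ff i; have [mG Gj] := Gf j; split; first exact: measurableX.
by rewrite product_measure1E// lte_mul_pinfty// ge0_fin_numE.
Qed.

(** Packed as a sigma-finite measure so that it can be a factor again: [product_law] works with
    three copies of [mu]. *)
Definition product_sigma_finite :
    {sigma_finite_measure set (T1 * T2)%type -> \bar R} :=
  HB.pack (m1 \x m2) (@Measure_isSigmaFinite.Build _ _ _ (m1 \x m2)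
    product_sigma_finite_proof).
End product_sigma_finite.

(** * Laws of the sum and of the product as integrals *)

Section laws.
Context (R : realType).
Local Notation mu := (@lebesgue_measure R).
Local Open Scope ereal_scope.

Local Notation mu2 := (product_sigma_finite mu mu).

Lemma sum_law d (T : measurableType d) (P : probability T R)
    (X Y : {RV P >-> R}) (f g : R -> R) (A : set R) :
  measurable_fun setT f -> (forall x, (0 <= f x)%R) ->
  measurable_fun setT g -> (forall x, (0 <= g x)%R) ->
  indep2 P X Y -> has_density P X f -> has_density P Y g -> measurable A ->
  P [set w | A (X w + Y w)%R] =
  \int[mu]_(s in A) \int[mu]_x (f x * g (s - x)%R)%:E.
Proof.
move=> mf f0 mg g0 iXY dX dY mA.
have mC : measurable [set z : R * R | A (z.1 + z.2)%R].
  have := @measurable_funD _ _ R setT _ _ (@measurable_fst _ _ R R) (@measurable_snd _ _ R R).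
  by move=> /(_ measurableT _ mA); rewrite setTI.
have Pfin : P setT < +oo by rewrite probability_setT ltry.
have mX : measurable_fun setT X by exact: measurable_funP.
have mY : measurable_fun setT Y by exact: measurable_funP.
have pXY B C : measurable B -> measurable C -> P (X @^-1` B `&` Y @^-1` C) =
    (\int[mu]_(x in B) (f x)%:E) * \int[mu]_(y in C) (g y)%:E.
  by move=> mB mC'; rewrite iXY// dX// dY.
have -> := @joint_density _ _ _ T (measurableTypeR R) (measurableTypeR R) R P
  mu mu X Y f g Pfin mX mY mf f0 mg g0 pXY _ mC.
have mfg1 : measurable_fun setT (fun z : R * R => (f z.1 * g z.2)%R).
  by apply: measurable_funM; [exact: (measurableT_comp mf measurable_fst) |
    exact: (measurableT_comp mg measurable_snd)].
have mfg2 : measurable_fun setT (fun z : R * R => (f z.1 * g (z.2 - z.1))%R).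
  apply: measurable_funM; first exact: (measurableT_comp mf measurable_fst).
  by apply: (measurableT_comp mg); mfun.
have mA2 : measurable [set z : R * R | A z.1].
  by have := @measurable_fst _ _ R R measurableT _ mA; rewrite setTI.
transitivity (\int[mu]_x \int[mu]_y
    ((f x * g y) * \1_[set z : R * R | A (z.1 + z.2)%R] (x, y))%:E).
  transitivity (\int[mu \x mu]_z (f z.1 * g z.2 *
     \1_[set z : R * R | A (z.1 + z.2)%R] z)%:E).
    rewrite integral_mkcond; apply: eq_integral => z _.
    by rewrite patchE indicE; case: ifPn; rewrite ?mulr1 ?mulr0.
  rewrite (@fubini_tonelli1 _ _ (measurableTypeR R) (measurableTypeR R) R mu mu)//.
  - by apply/measurable_EFinP/measurable_funM => //; exact: measurable_indic.
  - by move=> z; rewrite lee_fin !mulr_ge0.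
transitivity (\int[mu]_x \int[mu]_s
    ((f x * g (s - x)) * \1_[set z : R * R | A z.1] (s, x))%:E).
  apply: eq_integral => x _.
  etransitivity.
    apply: (@ge0_integral_subst R setT setT (fun s => s - x)%R (fun=> 1%R)
      (fun y => y + x)%R (fun y => (f x * g y *
        \1_[set z : R * R | A (z.1 + z.2)%R] (x, y))%:E)) => //.
    - exact: openT.
    - exact: openT.
    - by move=> s _; rewrite subrK.
    - by move=> s _; rewrite addrK.
    - by move=> s _; dereq; ring.
    - by move=> s _; dcont.
    - by left.
    - apply/measurable_EFinP/measurable_funM; first exact: measurable_funM.
      apply: (measurableT_comp _ (pair1_measurable x)).
      exact: measurable_indic.
    - by move=> y _; rewrite lee_fin !mulr_ge0.
  apply: eq_integral => s _; rewrite normr1 mule1; congr (_ * _)%:E.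
  rewrite !indicE (_ : ((x, _) \in _) = ((s, x) \in [set z : R * R | A z.1]))//.
  by apply/idP/idP => /set_mem h; apply/mem_set; move: h; rewrite /= addrC subrK.
rewrite (@fubini_tonelli _ _ (measurableTypeR R) (measurableTypeR R) R mu mu
  (fun z : R * R => (f z.1 * g (z.2 - z.1) * \1_[set z : R * R | A z.1] (z.2, z.1))%:E))/=.
- rewrite [RHS]integral_mkcond; apply: eq_integral => s _; rewrite patchE.
  case: ifPn => [/set_mem As|/negP As].
    by apply: eq_integral => x _; rewrite indicE mem_set// mulr1.
  rewrite integral0_eq// => x _; rewrite indicE memNset ?mulr0//.
  by move=> /= ?; apply/As/mem_set.
- apply/measurable_EFinP/measurable_funM => //.
  by apply: (measurableT_comp _ (@measurable_swap _ _ R R)); exact: measurable_indic.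
- by move=> z; rewrite lee_fin !mulr_ge0.
Qed.

Lemma product_law d (T : measurableType d) (Q : probability T R)
    (Y Z W : {RV Q >-> R}) (f g h : R -> R) (V : R * R -> R) (A : set R) :
  measurable_fun setT f -> (forall x, (0 <= f x)%R) ->
  measurable_fun setT g -> (forall x, (0 <= g x)%R) ->
  measurable_fun setT h -> (forall x, (0 <= h x)%R) ->
  measurable_fun setT V -> (forall z, (0 < V z)%R) ->
  indep3 Q Y Z W -> has_density Q Y f -> has_density Q Z g ->
  has_density Q W h -> measurable A ->
  Q [set w | A (Y w * V (Z w, W w))%R] =
  \int[mu]_(s in A) \int[product_sigma_finite mu mu]_z
    (f (s / V z) / V z * (g z.1 * h z.2))%:E.
Proof.
move=> mf f0 mg g0 mh h0 mV V0 iYZW dY dZ dW mA.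
have mgh : measurable_fun setT (fun z : R * R => (g z.1 * h z.2)%R).
  by apply: measurable_funM; [exact: (measurableT_comp mg measurable_fst) |
    exact: (measurableT_comp mh measurable_snd)].
have gh0 (z : R * R) : (0 <= g z.1 * h z.2)%R by rewrite mulr_ge0.
(* Mutual independence makes [Y] independent of the pair [(Z, W)]: for fixed [A1], [joint_density]
   is applied to [Z] and [W] under [Q] restricted to the event that [Y] lies in [A1], whose mass [c]
   is absorbed into the density of [Z]. *)
have step A1 (B : set (R * R)) : measurable A1 -> measurable B ->
    Q (Y @^-1` A1 `&` (fun w => (Z w, W w)) @^-1` B) =
    (\int[mu]_(x in A1) (f x)%:E) * \int[mu2]_(z in B) (g z.1 * h z.2)%:E.
  move=> mA1 mB.
  have mYA : measurable (Y @^-1` A1).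
    by rewrite -[X in measurable X]setTI; exact: measurable_funP.
  pose c := fine (Q (Y @^-1` A1)).
  have cE : c%:E = Q (Y @^-1` A1) by rewrite fineK// fin_num_measure.
  have c0 : (0 <= c)%R by rewrite fine_ge0.
  have mcg : measurable_fun setT (fun z => c * g z)%R by exact: measurable_funM.
  have cg0 z : (0 <= c * g z)%R by rewrite mulr_ge0.
  have mZ : measurable_fun setT Z by exact: measurable_funP.
  have mW : measurable_fun setT W by exact: measurable_funP.
  have Qr : mrestr Q mYA setT < +oo.
    by rewrite /mrestr setTI (le_lt_trans (probability_le1 _ _))// ltry.
  have pZW B1 B2 : measurable B1 -> measurable B2 ->
      mrestr Q mYA (Z @^-1` B1 `&` W @^-1` B2) =
      (\int[mu]_(x in B1) (c * g x)%:E) * \int[mu]_(y in B2) (h y)%:E.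
    move=> mB1 mB2; rewrite /mrestr/= setIC setIA iYZW// dZ// dW// -cE.
    under [in RHS]eq_integral do rewrite EFinM.
    rewrite ge0_integralZl_EFin//.
    + by move=> z _; rewrite lee_fin.
    + by apply/measurable_EFinP; exact: measurable_funTS.
  have E1 := @joint_density _ _ _ T (measurableTypeR R) (measurableTypeR R) R
    (mrestr Q mYA) mu mu Z W _ h Qr mZ mW mcg cg0 mh h0 pZW _ mB.
  rewrite -dY// -cE -ge0_integralZl_EFin//; last 2 first.
  - by move=> z _; rewrite lee_fin.
  - by apply/measurable_EFinP; exact: measurable_funTS.
  rewrite setIC -[LHS]/(mrestr Q mYA ((fun w => (Z w, W w)) @^-1` B)) E1.
  by apply: eq_integral => z _; rewrite -EFinM mulrA.
have mYV : measurable_fun setT (fun z : R * (R * R) => (z.1 * V z.2)%R).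
  by apply: measurable_funM; [exact: measurable_fst |
    exact: (measurableT_comp mV measurable_snd)].
have mC : measurable [set z : R * (R * R) | A (z.1 * V z.2)%R].
  by have := mYV measurableT _ mA; rewrite setTI.
have Qfin : Q setT < +oo by rewrite probability_setT ltry.
have mY : measurable_fun setT Y by exact: measurable_funP.
have mZW : measurable_fun setT (fun w => (Z w, W w)).
  by apply: measurable_fun_pair; exact: measurable_funP.
have -> := @joint_density _ _ _ T (measurableTypeR R)
  (measurableTypeR R * measurableTypeR R)%type R Q
  mu mu2 Y (fun w => (Z w, W w)) f (fun z => g z.1 * h z.2)%R
  Qfin mY mZW mf f0 mgh gh0 step _ mC.
have mfV : measurable_fun setT (fun z : R * (R * R) => (f (z.1 / V z.2) / V z.2 *
    (g z.2.1 * h z.2.2))%R).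
  have mVV : measurable_fun setT (fun z : R * (R * R) => (V z.2)^-1%R).
    apply: (measurableT_comp (@measurable_invr R)).
    exact: (measurableT_comp mV measurable_snd).
  apply: measurable_funM; last exact: (measurableT_comp mgh measurable_snd).
  apply: measurable_funM => //; apply: (measurableT_comp mf).
  by apply: measurable_funM => //; exact: measurable_fst.
have mA2 : measurable [set z : R * (R * R) | A z.1].
  by have := @measurable_fst _ _ R (R * R)%type measurableT _ mA; rewrite setTI.
have F0 (z : R * (R * R)) : (0 <= f (z.1 / V z.2) / V z.2 * (g z.2.1 * h z.2.2))%R.
  by rewrite mulr_ge0// mulr_ge0// invr_ge0 ltW.
have Fm : measurable_fun setT (fun z : R * (R * R) =>
   (f (z.1 / V z.2) / V z.2 * (g z.2.1 * h z.2.2) *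
     \1_[set z : R * (R * R) | A z.1] z)%:E).
  by apply/measurable_EFinP/measurable_funM => //; exact: measurable_indic.
transitivity (\int[mu2]_zw \int[mu]_y
    ((f y * (g zw.1 * h zw.2)) * \1_[set z : R * (R * R) | A (z.1 * V z.2)%R] (y, zw))%:E).
  transitivity (\int[mu \x mu2]_z (f z.1 * (g z.2.1 * h z.2.2) *
     \1_[set z : R * (R * R) | A (z.1 * V z.2)%R] z)%:E).
    rewrite integral_mkcond; apply: eq_integral => z _.
    by rewrite patchE indicE; case: ifPn; rewrite ?mulr1 ?mulr0.
  rewrite (@fubini_tonelli2 _ _ (measurableTypeR R)
    (measurableTypeR R * measurableTypeR R)%type R mu mu2)//.
  - apply/measurable_EFinP/measurable_funM; last exact: measurable_indic.
    by apply: measurable_funM; [exact: (measurableT_comp mf measurable_fst) |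
      exact: (measurableT_comp mgh measurable_snd)].
  - by move=> z; rewrite lee_fin !mulr_ge0.
(* For fixed [zw], the scaling [y = s / V zw] frees the indicator from [zw] and brings in the
   Jacobian [1 / V zw]. *)
transitivity (\int[mu2]_zw \int[mu]_s
   (f (s / V zw) / V zw * (g zw.1 * h zw.2) *
     \1_[set z : R * (R * R) | A z.1] (s, zw))%:E).
  apply: eq_integral => zw _.
  etransitivity.
    apply: (@ge0_integral_subst R setT setT (fun s => s / V zw)%R (fun=> (V zw)^-1%R)
      (fun y => y * V zw)%R (fun y => (f y * (g zw.1 * h zw.2) *
        \1_[set z : R * (R * R) | A (z.1 * V z.2)%R] (y, zw))%:E)) => //.
    - exact: openT.
    - exact: openT.
    - by move=> s _; rewrite divfK// gt_eqF.
    - by move=> s _; rewrite mulfK// gt_eqF.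
    - by move=> s _; dereq; ring.
    - by move=> s _; dcont.
    - by left => s _; rewrite invr_gt0.
    - apply/measurable_EFinP/measurable_funM; first exact: measurable_funM.
      apply: (measurableT_comp _ (pair2_measurable zw)).
      exact: measurable_indic.
    - by move=> y _; rewrite lee_fin !mulr_ge0.
  apply: eq_integral => s _; rewrite -EFinM gtr0_norm ?invr_gt0//; congr EFin.
  rewrite !indicE (_ : ((_, _) \in _) = ((s, zw) \in [set z : R * (R * R) | A z.1])).
    by ring.
  by apply/idP/idP => /set_mem h1; apply/mem_set; move: h1; rewrite /= divfK ?gt_eqF.
transitivity (\int[mu]_s \int[mu2]_zw (f (s / V zw) / V zw * (g zw.1 * h zw.2) *
     \1_[set z : R * (R * R) | A z.1] (s, zw))%:E).
  apply/esym; apply: (@fubini_tonelli _ _ (measurableTypeR R)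
    (measurableTypeR R * measurableTypeR R)%type R mu mu2
    (fun z : R * (R * R) => (f (z.1 / V z.2) / V z.2 * (g z.2.1 * h z.2.2) *
     \1_[set z : R * (R * R) | A z.1] z)%:E)); first exact: Fm.
  by move=> z; rewrite lee_fin mulr_ge0.
rewrite [RHS]integral_mkcond; apply: eq_integral => s _; rewrite patchE.
case: ifPn => [/set_mem As|/negP As].
  by apply: eq_integral => z _; rewrite indicE mem_set// mulr1.
rewrite integral0_eq// => x _; rewrite indicE memNset ?mulr0//.
by move=> /= ?; apply/As/mem_set.
Qed.
End laws.

(** * Densities up to a constant, and their proportionality *)

Section densities.
Context (R : realType).
Local Notation mu := (@lebesgue_measure R).

Definition betaprime_kernel (p q x : R) : R :=
  if 0 < x then x `^ (p - 1) / (1 + x) `^ (p + q) else 0.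
Definition beta_kernel (p q x : R) : R :=
  if (0 < x) && (x < 1) then x `^ (p - 1) * (1 - x) `^ (q - 1) else 0.
Definition beta_cst (p q : R) : R := Gammaf (p + q) / (Gammaf p * Gammaf q).

Lemma betaprime_densityE (p q : R) :
  betaprime_density p q = fun x => beta_cst p q * betaprime_kernel p q x.
Proof.
by apply/funext => x; rewrite /betaprime_density /betaprime_kernel; case: ifPn;
  rewrite ?mulr0// mulrA.
Qed.

Lemma beta_densityE (p q : R) :
  beta_density p q = fun x => beta_cst p q * beta_kernel p q x.
Proof.
by apply/funext => x; rewrite /beta_density /beta_kernel; case: ifPn;
  rewrite ?mulr0// mulrA.
Qed.

Lemma betaprime_kernel_ge0 (p q x : R) : 0 <= betaprime_kernel p q x.
Proof. by rewrite /betaprime_kernel; case: ifPn => // _; rewrite divr_ge0 ?powR_ge0. Qed.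

Lemma beta_kernel_ge0 (p q x : R) : 0 <= beta_kernel p q x.
Proof. by rewrite /beta_kernel; case: ifPn => // _; rewrite mulr_ge0 ?powR_ge0. Qed.

Lemma measurable_betaprime_kernel (p q : R) : measurable_fun setT (betaprime_kernel p q).
Proof.
apply: measurable_fun_ifT; first by apply: measurable_fun_ltr; mfun.
- by mfun.
- exact: measurable_cst.
Qed.

Lemma measurable_beta_kernel (p q : R) : measurable_fun setT (beta_kernel p q).
Proof.
apply: measurable_fun_ifT.
- by apply: measurable_and; apply: measurable_fun_ltr; mfun.
- by mfun.
- exact: measurable_cst.
Qed.

(** With [c <= 0] the total mass would be at most [0] instead of [1]. This gives the sign of the
    Gamma quotients without evaluating [Gammaf]. *)
Lemma density_cst_gt0 d (T : measurableType d) (P : probability T R)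
    (X : T -> R) (c : R) (f : R -> R) :
  (forall x, 0 <= f x) -> measurable_fun setT f ->
  has_density P X (fun x => c * f x) ->
  0 < c /\ (c%:E * \int[mu]_x (f x)%:E = 1)%E.
Proof.
move=> f0 mf /(_ _ measurableT); rewrite preimage_setT probability_setT => E1.
have I0 : (0 <= \int[mu]_x (f x)%:E)%E by apply: integral_ge0 => x _; rewrite lee_fin.
have c0 : 0 < c.
  rewrite ltNge; apply/negP => c0.
  have {}E1 : (1 = - \int[mu]_x (- c * f x)%:E)%E.
    rewrite -integral_ge0N; last by move=> x _; rewrite lee_fin mulr_ge0// oppr_ge0.
    rewrite E1; apply: eq_integral => x _.
    by rewrite -EFinN mulNr opprK.
  have : (0 <= \int[mu]_x (- c * f x)%:E)%E.
    by apply: integral_ge0 => x _; rewrite lee_fin mulr_ge0// oppr_ge0.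
  move=> h0; have : (1 <= 0 :> \bar R)%E by rewrite E1 oppe_le0.
  by rewrite lee_fin ler10.
split => //; rewrite E1 -ge0_integralZl_EFin//.
- by move=> x _; rewrite lee_fin.
- exact/measurable_EFinP.
- exact: ltW.
Qed.

Variables (a b : R).
Let p := a + b.
Let C1 := (\int[mu]_(y in `]0%R, +oo[)
  (y `^ (2 * p - b - 1) * (1 + y) `^ (- (2 * p)))%:E)%E.
Let C2 := (\int[mu]_(x in `]1%R, +oo[) ((x ^+ 2 - 1) `^ (- 2^-1 - b))%:E)%E.
Let CF := (\int[mu]_(t in `](-1)%R, 1%R[) ((1 - t ^+ 2) `^ (p - 1))%:E)%E.
Let V (z : R * R) := 1 + Num.sqrt (z.1 / z.2).

Let V0 z : 0 < V z.
Proof. by rewrite /V ltr_pwDl// sqrtr_ge0. Qed.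

Let mC1 : measurable_fun `](0 : R)%R, +oo[%classic
  (fun y : R => (y `^ (2 * p - b - 1) * (1 + y) `^ (- (2 * p)))%:E).
Proof. by mfun. Qed.

(** A zero integral would force the integrand to vanish almost everywhere, yet it is positive on
    []0, 1[], which has measure one. *)
Lemma betaprime_integral_gt0 : (0 < C1)%E.
Proof.
rewrite lt_neqAle; apply/andP; split; last first.
  by apply: integral_ge0 => y _; rewrite lee_fin mulr_ge0 ?powR_ge0.
apply/eqP => C10.
have : (\int[mu]_(y in `]0%R, +oo[)
  `|(y `^ (2 * p - b - 1) * (1 + y) `^ (- (2 * p)))%:E| = 0)%E.
  rewrite [RHS]C10; apply: eq_integral => y _.
  by rewrite gee0_abs// lee_fin mulr_ge0 ?powR_ge0.
move/(proj1 (ae_eq_integral_abs mu (measurable_itv _) mC1)) => [N [mN N0 sub]].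
have : (mu `]0%R, 1%R[%classic <= mu N)%E.
  apply: le_measure; rewrite ?inE// => y; rewrite /= in_itv/= => /andP[y0 y1].
  apply: sub => /= /(_ _); rewrite in_itv/= y0 => /(_ isT) [] /eqP.
  by rewrite gt_eqF// mulr_gt0 ?powR_gt0 ?addr_gt0.
by rewrite N0 lebesgue_measure_itv/= lte_fin ltr01 -EFinB lee_fin subr0 ler10.
Qed.

(** The integrand is the beta prime kernel [(2 a, b)] times [(y / (1 + y))^b], a factor at most [1];
    the hypothesis on [c] makes that kernel integrable. *)
Lemma betaprime_integral_lty (c : R) : 0 < b -> 0 < c ->
  (c%:E * \int[mu]_x (betaprime_kernel (2 * a) b x)%:E = 1)%E -> (C1 < +oo)%E.
Proof.
move=> b0 c0 E1; have I : (\int[mu]_x (betaprime_kernel (2 * a) b x)%:E < +oo)%E.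
  rewrite ltNge leye_eq; apply/eqP => E2; move: E1.
  by rewrite E2 gt0_muley// lte_fin.
have mK : measurable_fun setT (fun x : R => (betaprime_kernel (2 * a) b x)%:E).
  by apply/measurable_EFinP; exact: measurable_betaprime_kernel.
apply: le_lt_trans I; rewrite /C1 integral_mkcond.
apply: ge0_le_integral => //.
- move=> y _; rewrite patchE; case: ifPn => // _.
  by rewrite lee_fin mulr_ge0 ?powR_ge0.
- exact: (measurable_restrictT _ (measurable_itv _)).1 mC1.
move=> y _; rewrite patchE; case: ifPn; last by rewrite lee_fin betaprime_kernel_ge0.
rewrite inE/= in_itv/= andbT => y0; rewrite lee_fin /betaprime_kernel y0.
have y1 : 0 < 1 + y by rewrite addr_gt0.
have -> : y `^ (2 * p - b - 1) * (1 + y) `^ (- (2 * p)) =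
    (y `^ (2 * a - 1) / (1 + y) `^ (2 * a + b)) * (y / (1 + y)) `^ b.
  by rewrite /p; have [u ->] := gt0_expR y1; have [v ->] := gt0_expR y0; pw.
rewrite ler_piMr ?divr_ge0 ?powR_ge0// -[leRHS](@powRr0 _ (y / (1 + y))).
apply: ger_powR; last exact: ltW.
by rewrite divr_gt0//= ler_pdivrMr// mul1r lerDr.
Qed.

Lemma sum_density_eq (s c : R) : 0 < s -> 0 <= c ->
  (\int[mu]_x ((c * betaprime_kernel a b x) * (c * betaprime_kernel a b (s - x)))%:E =
   (c ^+ 2)%:E * \int[mu]_(x in `]0%R, s[)
    (x `^ (a - 1) * (s - x) `^ (a - 1) * ((1 + x) * (1 + (s - x))) `^ (- p))%:E)%E.
Proof.
move=> s0 c0.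
rewrite -ge0_integralZl_EFin//; last 3 first.
- by move=> x _; rewrite lee_fin !mulr_ge0 ?powR_ge0.
- by mfun.
- exact: exprn_ge0.
rewrite [RHS]integral_mkcond; apply: eq_integral => x _.
rewrite patchE; case: ifPn => [/set_mem /=|/negP xs];
  rewrite /betaprime_kernel subr_gt0.
  rewrite in_itv/= => /andP[x0 xs]; rewrite x0 xs -EFinM; congr EFin.
  have h1 : 0 < 1 + x by rewrite addr_gt0.
  have h2 : 0 < 1 + (s - x) by rewrite addr_gt0 ?subr_gt0.
  rewrite powRN powRM ?ltW// invfM -/p; ring.
have [x0|x0] := ltP 0 x; last by rewrite mulr0 mul0r.
have [xs'|xs'] := ltP x s; last by rewrite !mulr0.
by exfalso; apply: xs; apply/mem_set; rewrite /= in_itv/= x0.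
Qed.

(** Since [2 a + b = 2 p - b], the kernel at [s / v] and the Jacobian [1 / v] combine into
    [s^(2 a - 1) v^b (v + s)^(b - 2 p)], where [v = 1 + sqrt (z / w)]. *)
Lemma product_density_eq (s cY cZ cW : R) : 0 < s -> 0 <= cY -> 0 <= cZ -> 0 <= cW ->
  (\int[product_sigma_finite mu mu]_z
    ((cY * betaprime_kernel (2 * a) b (s / V z)) / V z *
     ((cZ * beta_kernel a (1 / 2) z.1) * (cW * beta_kernel b (1 / 2 - b) z.2)))%:E =
   (cY * cZ * cW * s `^ (2 * a - 1))%:E *
   \int[mu]_(z in `]0%R, 1%R[) \int[mu]_(w in `]0%R, 1%R[)
    (z `^ (a - 1) * (1 - z) `^ (- 2^-1) * (w `^ (b - 1) * (1 - w) `^ (- 2^-1 - b) *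
    ((1 + Num.sqrt (z / w)) `^ b * (1 + Num.sqrt (z / w) + s) `^ (b - 2 * p))))%:E)%E.
Proof.
move=> s0 cY0 cZ0 cW0.
have mV : measurable_fun setT V by rewrite /V; mfun.
rewrite (@fubini_tonelli1 _ _ (measurableTypeR R) (measurableTypeR R) R mu mu); last 2 first.
- apply/measurable_EFinP/measurable_funM.
    apply: measurable_funM; last exact: (measurableT_comp (@measurable_invr R)).
    apply: measurable_funM => //; apply: (measurableT_comp (measurable_betaprime_kernel _ _)).
    by apply: measurable_funM => //; exact: (measurableT_comp (@measurable_invr R)).
  apply: measurable_funM; apply: measurable_funM => //.
    exact: (measurableT_comp (measurable_beta_kernel _ _) measurable_fst).
  exact: (measurableT_comp (measurable_beta_kernel _ _) measurable_snd).
- by move=> z; rewrite lee_fin !mulr_ge0 ?betaprime_kernel_ge0 ?beta_kernel_ge0// invr_ge0 ltW.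
set c := cY * cZ * cW * s `^ (2 * a - 1).
have c0 : 0 <= c by rewrite !mulr_ge0 ?powR_ge0.
rewrite -ge0_integralZl_EFin//; last 2 first.
- by move=> z _; apply: integral_ge0 => w _; rewrite lee_fin !mulr_ge0 ?powR_ge0.
- apply: measurable_fun_integral_param => //.
  + rewrite (_ : [set z | _] = [set z : R * R | (((0 < z.1) && (z.1 < 1)) &&
      ((0 < z.2) && (z.2 < 1)))%R]).
      by apply: measurable_set_bool; apply: measurable_and; apply: measurable_and;
        apply: measurable_fun_ltr; mfun.
    by apply/seteqP; split => z /=; rewrite !in_itv/= => /andP.
  + by mfun.
  + by move=> z w _ _; rewrite lee_fin !mulr_ge0 ?powR_ge0.
rewrite [RHS]integral_mkcond; apply: eq_integral => z _; rewrite patchE /fubini_F.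
case: ifPn => [/set_mem /=|/negP z01]; last first.
  rewrite integral0_eq// => w _; rewrite /= {1}/beta_kernel ifF ?mulr0 ?mul0r ?mulr0//.
  by apply/negP => z01'; apply: z01; apply/mem_set; rewrite /= in_itv.
rewrite in_itv/= => z01.
rewrite -ge0_integralZl_EFin//; last 2 first.
- by move=> w _; rewrite lee_fin !mulr_ge0 ?powR_ge0.
- by mfun.
rewrite [RHS]integral_mkcond; apply: eq_integral => w _; rewrite patchE.
case: ifPn => [/set_mem /=|/negP w01]; last first.
  rewrite /= [beta_kernel b _ _]/beta_kernel ifF ?mulr0//.
  by apply/negP => w01'; apply: w01; apply/mem_set; rewrite /= in_itv.
rewrite in_itv/= => w01; rewrite -EFinM; congr EFin.
rewrite /beta_kernel z01 w01 /betaprime_kernel divr_gt0//=.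
have e1 : (1 / 2 - 1 = - 2^-1 :> R) by field.
have e2 : (1 / 2 - b - 1 = - 2^-1 - b :> R) by field.
rewrite e1 e2.
have := V0 (z, w); rewrite /V /=; set v := 1 + Num.sqrt (z / w) => v0.
have vs : 0 < v + s by rewrite addr_gt0.
have -> : 1 + s / v = (v + s) / v by field; nz.
have H : (s / v) `^ (2 * a - 1) / ((v + s) / v) `^ (2 * a + b) / v =
    s `^ (2 * a - 1) * (v `^ b * (v + s) `^ (b - 2 * p)).
  rewrite /p; have [u1 ->] := gt0_expR vs; have [u2 ->] := gt0_expR v0.
  by have [u3 ->] := gt0_expR s0; pw.
rewrite -[cY * _ / v]mulrA H /c; ring.
Qed.

(** Cross-multiplication of [sum_density] and [product_density], which share the same [S s]; it
    avoids dividing by constants that might be infinite. The factor [4 * 4^(1 - p)] comes from the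
    product side and [4 * 2^(1 - 2 a)] from [4 (s / 2)^(2 a - 1)]. For [s <= 0] both densities
    vanish. *)
Lemma density_proportional (s c cY cZ cW : R) :
  0 < c -> 0 < cY -> 0 < cZ -> 0 < cW ->
  (C2 * (4 * 4 `^ (1 - p))%:E * CF * (cY * cZ * cW)%:E *
    \int[mu]_x ((c * betaprime_kernel a b x) * (c * betaprime_kernel a b (s - x)))%:E =
   C1 * (c ^+ 2 * (4 * 2 `^ (1 - 2 * a)))%:E *
   \int[product_sigma_finite mu mu]_z
    ((cY * betaprime_kernel (2 * a) b (s / V z)) / V z *
     ((cZ * beta_kernel a (1 / 2) z.1) * (cW * beta_kernel b (1 / 2 - b) z.2)))%:E)%E.
Proof.
move=> c0 cY0 cZ0 cW0.
have [s0|s0] := ltP 0 s; last first.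
  rewrite integral0_eq ?mule0; last first.
    move=> x _; rewrite /betaprime_kernel subr_gt0.
    have [x0|x0] := ltP 0 x; last by rewrite mulr0 mul0r.
    by rewrite ifF ?mulr0//; apply/negbTE; rewrite -leNgt (le_trans s0)// ltW.
  rewrite integral0_eq ?mule0// => z _; rewrite /betaprime_kernel ifF ?mulr0 ?mul0r//.
  by apply/negbTE; rewrite -leNgt pmulr_lle0// invr_gt0.
rewrite sum_density_eq ?ltW// product_density_eq ?ltW//.
have := @sum_density R a b s s0; have := @product_density R a b s s0.
rewrite -/p -/C1 -/C2 -/CF.
set Rr := (\int[mu]_(z in `]0%R, 1%R[) _)%E; set L := (\int[mu]_(x in `]0%R, s[) _)%E.
set S := (\int[mu]_(v in _) _)%E => E1 E2.
have s2 : (s / 2) `^ (2 * a - 1) = 2 `^ (1 - 2 * a) * s `^ (2 * a - 1).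
  have [u ->] := gt0_expR s0.
  by have [v ->] := @gt0_expR R 2 (ltr0n _ 2); pw.
rewrite -!muleA (muleA (_ * _ * _)%:E) (muleCA CF) E2 -EFinM (muleA _ _ S) -EFinM.
rewrite (muleA (c ^+ 2 * _)%:E) -EFinM (muleCA C1) E1 -!muleA (muleCA _ _ S) (muleCA C2).
by congr (_%:E * _)%E; rewrite s2; ring.
Qed.

End densities.

(** * Equality of the two laws *)

Theorem theoremB (R : realType) (a b : R) :
  0 < b -> b < 1 / 2 -> (a = 1 - b \/ a = 1 / 2) ->
  forall (d : measure_display) (T : measurableType d) (P : probability T R)
    (X1 X2 : {RV P >-> R}),
  indep2 P X1 X2 ->
  has_density P X1 (betaprime_density a b) ->
  has_density P X2 (betaprime_density a b) ->
  forall (d' : measure_display) (T' : measurableType d') (Q : probability T' R)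
    (Y Z W : {RV Q >-> R}),
  indep3 Q Y Z W ->
  has_density Q Y (betaprime_density (2 * a) b) ->
  has_density Q Z (beta_density a (1 / 2)) ->
  has_density Q W (beta_density b (1 / 2 - b)) ->
  forall A : set R, measurable A ->
    P [set w | A (X1 w + X2 w)]
    = Q [set w | A (Y w * (1 + Num.sqrt (Z w / W w)))].
Proof.
move=> b0 _ _ d T P X1 X2 iX dX1 dX2 d' T' Q Y Z W iYZW dY dZ dW A mA.
rewrite betaprime_densityE in dX1; rewrite betaprime_densityE in dX2.
rewrite betaprime_densityE in dY; rewrite beta_densityE in dZ.
rewrite beta_densityE in dW.
have [c0 _] := density_cst_gt0 (betaprime_kernel_ge0 _ _) (measurable_betaprime_kernel _ _) dX1.
have [cY0 cY1] := density_cst_gt0 (betaprime_kernel_ge0 _ _) (measurable_betaprime_kernel _ _) dY.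
have [cZ0 _] := density_cst_gt0 (beta_kernel_ge0 _ _) (measurable_beta_kernel _ _) dZ.
have [cW0 _] := density_cst_gt0 (beta_kernel_ge0 _ _) (measurable_beta_kernel _ _) dW.
have C10 := betaprime_integral_gt0 a b.
have C1y := betaprime_integral_lty b0 cY0 cY1.
have prop s := density_proportional a b s c0 cY0 cZ0 cW0.
move: c0 cY0 cZ0 cW0 C10 C1y prop dX1 dX2 dY dZ dW {cY1}.
set c := beta_cst a b; set cY := beta_cst (2 * a) b; set cZ := beta_cst a (1 / 2).
set cW := beta_cst b (1 / 2 - b); set C1 := (\int[_]_(y in _) _)%E.
clearbody c cY cZ cW.
move=> c0 cY0 cZ0 cW0 C10 C1y prop dX1 dX2 dY dZ dW.
set f := fun x => c * betaprime_kernel a b x in dX1 dX2 *.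
set g := fun x => cY * betaprime_kernel (2 * a) b x in dY *.
set h := fun x => cZ * beta_kernel a (1 / 2) x in dZ *.
set k := fun x => cW * beta_kernel b (1 / 2 - b) x in dW *.
pose V (z : R * R) := 1 + Num.sqrt (z.1 / z.2).
have V0 z : 0 < V z by rewrite /V ltr_pwDl// sqrtr_ge0.
have mV : measurable_fun setT V by rewrite /V; mfun.
have mf : measurable_fun setT f.
  by apply: measurable_funM => //; exact: measurable_betaprime_kernel.
have mg : measurable_fun setT g.
  by apply: measurable_funM => //; exact: measurable_betaprime_kernel.
have mh : measurable_fun setT h.
  by apply: measurable_funM => //; exact: measurable_beta_kernel.
have mk : measurable_fun setT k.
  by apply: measurable_funM => //; exact: measurable_beta_kernel.
have f0 x : 0 <= f x by rewrite mulr_ge0 ?betaprime_kernel_ge0 ?ltW.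
have g0 x : 0 <= g x by rewrite mulr_ge0 ?betaprime_kernel_ge0 ?ltW.
have h0 x : 0 <= h x by rewrite mulr_ge0 ?beta_kernel_ge0 ?ltW.
have k0 x : 0 <= k x by rewrite mulr_ge0 ?beta_kernel_ge0 ?ltW.
have lawP B : measurable B -> _ := sum_law mf f0 mf f0 iX dX1 dX2.
have lawQ B : measurable B -> _ :=
  product_law mg g0 mh h0 mk k0 mV V0 iYZW dY dZ dW.
pose L s := (\int[@lebesgue_measure R]_x (f x * f (s - x))%:E)%E.
pose M s := (\int[product_sigma_finite (@lebesgue_measure R) (@lebesgue_measure R)]_z
  (g (s / V z) / V z * (h z.1 * k z.2))%:E)%E.
have L0 s : (0 <= L s)%E by apply: integral_ge0 => x _; rewrite lee_fin mulr_ge0.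
have M0 s : (0 <= M s)%E.
  apply: integral_ge0 => z _; rewrite lee_fin.
  by apply: mulr_ge0; [apply: divr_ge0 => //; exact: ltW|exact: mulr_ge0].
have mL : measurable_fun setT L.
  apply: (@measurable_fun_fubini_tonelli_F _ _ (measurableTypeR R)
    (measurableTypeR R) R (@lebesgue_measure R)
    (fun z => (f z.2 * f (z.1 - z.2))%:E)) => [|z]; last by rewrite lee_fin mulr_ge0.
  apply/measurable_EFinP/measurable_funM; apply: (measurableT_comp mf) => //.
  exact: measurable_funB.
have mM : measurable_fun setT M.
  apply: (@measurable_fun_fubini_tonelli_F _ _ (measurableTypeR R)
    (measurableTypeR R * measurableTypeR R)%type R
    (product_sigma_finite (@lebesgue_measure R) (@lebesgue_measure R))
    (fun z => (g (z.1 / V z.2) / V z.2 * (h z.2.1 * k z.2.2))%:E)) => [|z]; last first.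
    rewrite lee_fin.
    by apply: mulr_ge0; [apply: divr_ge0 => //; exact: ltW|exact: mulr_ge0].
  have mV2 := measurableT_comp (measurableT_comp (@measurable_invr R) mV)
    (@measurable_snd _ _ (measurableTypeR R) (measurableTypeR R * measurableTypeR R)%type).
  apply/measurable_EFinP/measurable_funM.
    apply: measurable_funM => //.
    by apply: (measurableT_comp mg); apply: measurable_funM.
  apply: measurable_funM.
    exact: (measurableT_comp mh (measurableT_comp measurable_fst measurable_snd)).
  exact: (measurableT_comp mk (measurableT_comp measurable_snd measurable_snd)).
(* Of the constant integrals, [be] contains only [C1], whose bounds are known. For [al], which
   contains [C2] and [CF], nonnegativity is enough to pull it out of integrals. *)
move: prop; set al := (_ * _ * _ * _)%E; set be := (C1 * _)%E => prop.
have al0 : (0 <= al)%E.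
  apply: mule_ge0; last by rewrite lee_fin ltW// !mulr_gt0.
  apply: mule_ge0; last by apply: integral_ge0 => x _; rewrite lee_fin powR_ge0.
  apply: mule_ge0; last by rewrite lee_fin mulr_ge0// powR_ge0.
  by apply: integral_ge0 => x _; rewrite lee_fin powR_ge0.
have be0 : (0 < be)%E.
  by rewrite /be mule_gt0// lte_fin !mulr_gt0 ?exprn_gt0 ?powR_gt0.
have bey : (be < +oo)%E.
  rewrite /be; case: (C1) C10 C1y => [r| |]// _ _; exact: ltry.
have eqPQ B : measurable B -> (al * P [set w | B (X1 w + X2 w)%R] =
    be * Q [set w | B (Y w * (1 + Num.sqrt (Z w / W w)))%R])%E.
  move=> mB; rewrite lawP//.
  rewrite -[X in _ = (_ * Q X)%E]/[set w | B (Y w * V (Z w, W w))] lawQ//.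
  transitivity (\int[@lebesgue_measure R]_(s in B) (al * L s))%E.
    by rewrite ge0_integralZl//; exact: measurable_funTS.
  transitivity (\int[@lebesgue_measure R]_(s in B) (be * M s))%E.
    by apply: eq_integral => s _; exact: prop.
  by rewrite ge0_integralZl ?ltW//; exact: measurable_funTS.
(* Taking the whole line for [B], both probabilities are one, so the two factors coincide; in
   particular [al] is finite and positive too. *)
have albe : al = be.
  have := eqPQ _ measurableT.
  by rewrite (_ : [set w | setT _] = setT)// (_ : [set w | setT _] = setT :> set T')//
    !probability_setT !mule1.
have := eqPQ _ mA; rewrite albe.
(* [be] is now a positive real number and cancels. *)
case: be be0 bey {albe eqPQ prop} => [r| |]//; rewrite lte_fin => r0 _.
move=> /(congr1 (fun x => (r^-1)%:E * x)%E).
by rewrite !muleA -EFinM mulVf ?gt_eqF// !mul1e.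
Qed.
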